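(* Let $n\ge1$ and $0<p<\infty$. There is a finite constant $B_{p,n}$ such that for all nonnegative functions $F,G\in L^p(\mathbb{S}^n)$, $$\|F\|_{L^p(\mathbb{S}^n)}\,\|G\|_{L^p(\mathbb{S}^n)}\le B_{p,n}\,\sup_{s,t\in\mathbb{S}^n}F(s)G(t)\,|s-t|^{2n/p}.$$ The best constant $B_{p,n}$ is obtained when $F$ and $G$ are (nonzero) constant functions, and its value is $B_{p,n}=2^{-2n/p}\,|\mathbb{S}^n|^{2/p}$.
   Context: $\mathbb{S}^n$ is the unit sphere in $\mathbb{R}^{n+1}$ with its surface measure, $|\mathbb{S}^n|$ is its surface area, and $|s-t|$ is the Euclidean distance in $\mathbb{R}^{n+1}$. $\|F\|_{L^p}=(\int|F|^p)^{1/p}$ (also for $p<1$). $\sup$ denotes the essential supremum with respect to the product of the surface measures. *)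

(* Defs.v *)
From HB Require Import structures.
From mathcomp Require Import all_boot all_order all_algebra.
From mathcomp Require Import all_classical all_reals all_analysis.
From mathcomp Require Import measurable_realfun ess_sup_inf hoelder.

Set Implicit Arguments.
Unset Strict Implicit.
Unset Printing Implicit Defensive.

Import Order.TTheory GRing.Theory Num.Theory.
Import numFieldNormedType.Exports.

Local Open Scope classical_set_scope.
Local Open Scope ring_scope.

(* 'rV[R]_n carries the sup norm and no sigma-algebra, hence points of R^n are
   n-tuples, with the library's product (= Borel) sigma-algebra on n.-tuple R
   and an explicit Euclidean norm. *)
Section euclidean.
Context {R : realType}.

Definition scale_tuple n (r : R) (x : n.-tuple R) : n.-tuple R :=
  [tuple r * tnth x i | i < n].

Definition enorm n (x : n.-tuple R) : R :=
  Num.sqrt (\sum_(i < n) tnth x i ^+ 2).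

Definition edist n (x y : n.-tuple R) : R :=
  Num.sqrt (\sum_(i < n) (tnth x i - tnth y i) ^+ 2).

Lemma enorm_ge0 n (x : n.-tuple R) : 0 <= enorm x.
Proof. exact: sqrtr_ge0. Qed.

Lemma enorm_scale n (r : R) (x : n.-tuple R) :
  0 <= r -> enorm (scale_tuple r x) = r * enorm x.
Proof.
move=> r0; rewrite /enorm -[in RHS](ger0_norm r0) -sqrtr_sqr.
rewrite -sqrtrM ?sqr_ge0// mulr_sumr; congr Num.sqrt.
by apply: eq_bigr => i _; rewrite tnth_mktuple exprMn.
Qed.

Lemma tnth_le_enorm n (x : n.-tuple R) i : `|tnth x i| <= enorm x.
Proof.
rewrite -sqrtr_sqr ler_wsqrtr// (bigD1 i)//= lerDl.
by apply: sumr_ge0 => j _; exact: sqr_ge0.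
Qed.

Lemma scale_tupleA n (r s : R) (x : n.-tuple R) :
  scale_tuple r (scale_tuple s x) = scale_tuple (r * s) x.
Proof. by apply: eq_from_tnth => i; rewrite !tnth_mktuple mulrA. Qed.

Lemma scale_tuple1 n (x : n.-tuple R) : scale_tuple 1 x = x.
Proof. by apply: eq_from_tnth => i; rewrite tnth_mktuple mul1r. Qed.

Lemma measurable_enorm n : measurable_fun [set: n.-tuple R] (@enorm n).
Proof.
rewrite (_ : @enorm n = (@powR R ^~ 2^-1) \o
    (fun x : n.-tuple R => \sum_(i < n) tnth x i ^+ 2)); last first.
  apply/funext => x /=; rewrite powR12_sqrt//.
  by apply: sumr_ge0 => i _; exact: sqr_ge0.
apply: measurableT_comp; first exact: measurable_powR.
apply: measurable_sum => i; apply: measurable_funX; exact: measurable_tnth.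
Qed.

Lemma measurable_normalize n :
  measurable_fun [set: n.-tuple R]
    (fun x : n.-tuple R => scale_tuple (enorm x)^-1 x).
Proof.
apply/measurable_fun_tnthP => i.
rewrite (_ : _ \o _ =
    (fun x : n.-tuple R => enorm x `^ (-1) * tnth x i)); last first.
  by apply/funext => x /=; rewrite tnth_mktuple powR_inv1// enorm_ge0.
apply: measurable_funM; last exact: measurable_tnth.
apply: (measurableT_comp (f := @powR R ^~ (-1))).
  exact: measurable_powR.
exact: measurable_enorm.
Qed.

End euclidean.

(* Lebesgue measure on R^n, by induction on n: the product measure
   lebesgue_measure \x lebesgue_tuple n, transported along the bijection
   R * R^n -> R^n.+1; on R^0 it is the unit mass at the empty tuple. *)
Section lebesgue_tuple.
Context {R : realType}.

Definition cons_pair n (x : measurableTypeR R * n.-tuple R) : n.+1.-tuple R :=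
  [tuple of x.1 :: x.2].

Lemma measurable_cons_pair n : measurable_fun setT (@cons_pair n).
Proof.
apply: (@measurable_cons _ _ _ _ _ n snd).
- exact: measurable_fst.
- exact: measurable_snd.
Qed.

Section step.
Variables (n : nat) (m : {sigma_finite_measure set n.-tuple R -> \bar R}).

Definition lebesgue_cons : set (n.+1.-tuple R) -> \bar R :=
  pushforward (lebesgue_measure \x m)%E (@cons_pair n).

Let lebesgue_cons0 : lebesgue_cons set0 = 0%E.
Proof. by rewrite /lebesgue_cons /pushforward preimage_set0 measure0. Qed.

Let lebesgue_cons_ge0 A : (0 <= lebesgue_cons A)%E.
Proof. exact: (measure_ge0 (lebesgue_measure \x m)%E). Qed.

Let lebesgue_cons_sigma_additive : semi_sigma_additive lebesgue_cons.
Proof.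
move=> F mF tF mUF; rewrite /lebesgue_cons /pushforward preimage_bigcup.
apply: measure_semi_sigma_additive.
- by move=> k; rewrite -[X in measurable X]setTI; exact: measurable_cons_pair.
- apply/trivIsetP => /= i j _ _ ij; rewrite -preimage_setI.
  by move/trivIsetP : tF => /(_ _ _ _ _ ij) ->//; rewrite preimage_set0.
- rewrite -preimage_bigcup -[X in measurable X]setTI.
  exact: measurable_cons_pair.
Qed.

HB.instance Definition _ := isMeasure.Build _ _ _ lebesgue_cons
  lebesgue_cons0 lebesgue_cons_ge0 lebesgue_cons_sigma_additive.

Let lebesgue_cons_sigma_finite : sigma_finite setT lebesgue_cons.
Proof.
have /sigma_finiteP[F [FT ndF Foo]] := sigma_finiteT (@lebesgue_measure R).
have /sigma_finiteP[G [GT ndG Goo]] := sigma_finiteT m.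
pose FG k : set (n.+1.-tuple R) :=
  [set x | F k (thead x) /\ G k [tuple of behead x]].
have FGE k : @cons_pair n @^-1` FG k = F k `*` G k.
  have bE (x : R) (y : n.-tuple R) : [tuple of behead [tuple of x :: y]] = y.
    exact/val_inj.
  by apply/seteqP; split=> -[x y]; rewrite /FG /cons_pair/= theadE bE.
exists FG.
  apply/seteqP; split=> // x _.
  have : (\bigcup_k F k) (thead x) by rewrite -FT.
  have : (\bigcup_k G k) [tuple of behead x] by rewrite -GT.
  move=> [j _ Gj] [i _ Fi]; exists (maxn i j) => //; split.
    by move: Fi; exact/subsetPset/ndF/leq_maxl.
  by move: Gj; exact/subsetPset/ndG/leq_maxr.
move=> k; have [mF Fk] := Foo k; have [mG Gk] := Goo k; split.
  apply: measurableI.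
    rewrite -[X in measurable X]setTI.
    exact: (@measurable_tnth _ _ _ ord0 measurableT (F k)).
  rewrite -[X in measurable X]setTI.
  exact: (@measurable_behead _ _ n measurableT (G k)).
rewrite /lebesgue_cons /pushforward FGE product_measure1E//.
by rewrite lte_mul_pinfty// ge0_fin_numE.
Qed.

HB.instance Definition _ := Measure_isSigmaFinite.Build _ _ _ lebesgue_cons
  lebesgue_cons_sigma_finite.

End step.

Fixpoint lebesgue_tuple n : {sigma_finite_measure set n.-tuple R -> \bar R} :=
  if n is n'.+1 then lebesgue_cons (lebesgue_tuple n')
  else \d_ ([tuple] : 0.-tuple R).

Let cube n : set (n.-tuple R) := [set x | forall i, `|tnth x i| <= 1].

Let measurable_cube n : measurable (@cube n).
Proof.
rewrite (_ : @cube n = \bigcap_(i in [set: 'I_n])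
    ((fun x : n.-tuple R => tnth x i) @^-1` `[-1, 1])); last first.
  apply/seteqP; split=> x /= xn i.
    by move=> _; rewrite /= in_itv/= -ler_norml.
  by have := xn i Logic.I; rewrite /= in_itv/= -ler_norml.
apply: fin_bigcap_measurable => // i _.
by rewrite -[X in measurable X]setTI; exact: measurable_tnth.
Qed.

Let lebesgue_cube n : (lebesgue_tuple n (@cube n) < +oo)%E.
Proof.
elim: n => [|n ih].
  by rewrite /= diracE ltry.
rewrite /= /lebesgue_cons /pushforward.
rewrite (_ : _ @^-1` _ = `[-1, 1]%classic `*` @cube n); last first.
  apply/seteqP; split=> -[a x]/=.
    move=> ax; split.
      by have := ax ord0; rewrite (tnth_nth 0)/= in_itv/= -ler_norml.
    by move=> i; have := ax (lift ord0 i); rewrite tnthS.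
  rewrite in_itv/= -ler_norml => -[a1 x1] i.
  by case: (unliftP ord0 i) => [j|] ->; rewrite ?tnthS//= (tnth_nth 0).
have l1 : (lebesgue_measure (`[(-1)%R, 1%R]%classic : set R) < +oo)%E.
  by rewrite lebesgue_measure_itv/=; case: ifP; rewrite ltry.
rewrite product_measure1E//; last exact: measurable_cube.
by rewrite lte_mul_pinfty// ge0_fin_numE.
Qed.

Lemma lebesgue_tuple_unit_ball n (A : set (n.-tuple R)) : measurable A ->
  A `<=` [set x | enorm x < 1] -> (lebesgue_tuple n A < +oo)%E.
Proof.
move=> mA A1; apply: le_lt_trans (lebesgue_cube n).
apply: le_measure; rewrite ?inE//; first exact: measurable_cube.
by move=> x /A1 /= /ltW x1 i; exact: le_trans (tnth_le_enorm _ _) _.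
Qed.

End lebesgue_tuple.

Section sphere.
Variables (R : realType) (n : nat).

Record sphere := Sphere {
  sphere_val :> n.+1.-tuple R ;
  sphere_valP : enorm sphere_val == 1 }.

HB.instance Definition _ := [isSub for sphere_val].
HB.instance Definition _ := [Choice of sphere by <:].

Let enorm_pole :
  enorm [tuple (if i == ord0 then 1 else 0 : R) | i < n.+1] == 1.
Proof.
rewrite /enorm (bigD1 ord0)//= big1 ?addr0.
  by rewrite tnth_mktuple eqxx expr1n sqrtr1.
by move=> i /negbTE i0; rewrite tnth_mktuple i0 expr0n.
Qed.

HB.instance Definition _ := isPointed.Build sphere (Sphere enorm_pole).

(* the trace on the sphere of the Borel sigma-algebra of R^n.+1 *)
HB.instance Definition _ :=
  Measurable.copy sphere (g_sigma_algebra_preimageType sphere_val).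

Definition cone (A : set sphere) : set (n.+1.-tuple R) :=
  [set x | exists r s, [/\ 0 < r < 1, A s & x = scale_tuple r s]].

(* The area of A is n + 1 times the volume of the cone over A: sigma is the
   measure of the polar coordinates formula dx = r^n dr dsigma(s). *)
Definition surface_measure (A : set sphere) : \bar R :=
  (n.+1%:R%:E * lebesgue_tuple n.+1 (cone A))%E.

Lemma sphere_enorm (s : sphere) : enorm s = 1.
Proof. exact/eqP/sphere_valP. Qed.

Lemma scale_sphere_inj (r r' : R) (s s' : sphere) : 0 < r -> 0 < r' ->
  scale_tuple r s = scale_tuple r' s' -> r = r' /\ s = s'.
Proof.
move=> r0 r'0 e; have rr' : r = r'.
  by have := congr1 (@enorm R n.+1) e;
    rewrite !enorm_scale ?ltW// !sphere_enorm !mulr1.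
split=> //; apply/val_inj => /=; move: e; rewrite -rr'.
move=> /(congr1 (scale_tuple r^-1)); rewrite !scale_tupleA mulVf ?gt_eqF//.
by rewrite !scale_tuple1.
Qed.

Lemma measurable_cone A : measurable A -> measurable (cone A).
Proof.
move=> [B mB]; rewrite setTI => <-.
rewrite (_ : cone _ = [set x | enorm x \in `]0, 1[ ] `&`
    ((fun x => scale_tuple (enorm x)^-1 x) @^-1` B)); last first.
  apply/seteqP; split=> x /=.
    move=> [r [s [/andP[r0 r1] Bs ->]]].
    rewrite scale_tupleA enorm_scale ?ltW// sphere_enorm mulr1 in_itv/= r0 r1.
    by rewrite mulVf ?gt_eqF// scale_tuple1.
  rewrite in_itv/= => -[/andP[x0 x1] Bx].
  have xP : enorm (scale_tuple (enorm x)^-1 x) == 1.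
    by rewrite enorm_scale ?invr_ge0 ?ltW// mulVf// gt_eqF.
  exists (enorm x), (Sphere xP); split => //; first by rewrite x0.
  by rewrite /= scale_tupleA mulfV ?gt_eqF// scale_tuple1.
apply: measurableI; rewrite -[X in measurable X]setTI.
  by apply: (@measurable_enorm R n.+1 measurableT `]0, 1[%classic).
exact: (@measurable_normalize R n.+1 measurableT B).
Qed.

Let surface_measure0 : surface_measure set0 = 0%E.
Proof.
rewrite /surface_measure (_ : cone set0 = set0) ?measure0 ?mule0//.
by rewrite -subset0 => x [r [s []]].
Qed.

Let surface_measure_ge0 A : (0 <= surface_measure A)%E.
Proof. by rewrite mule_ge0// lee_fin. Qed.

Let surface_measure_sigma_additive : semi_sigma_additive surface_measure.
Proof.
move=> F mF tF mUF.
rewrite /surface_measure (_ : cone _ = \bigcup_k cone (F k)); last first.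
  apply/seteqP; split=> x.
    by move=> [r [s [r01 [k _ Fks] ->]]]; exists k => //; exists r, s.
  by move=> [k _ [r [s [r01 Fks ->]]]]; exists r, s; split=> //; exists k.
apply: (@measure_semi_sigma_additive _ _ _
  (mscale n.+1%:R%:nng (lebesgue_tuple n.+1)) (fun k => cone (F k))).
- by move=> k; exact: measurable_cone.
- move=> i j _ _ [x [[r [s [/andP[r0 _] Fis ->]]]]].
  move=> [r' [s' [/andP[r'0 _] Fjs' e]]].
  have [_ ss'] := scale_sphere_inj r0 r'0 e.
  by apply: tF => //; exists s; split=> //; rewrite ss'.
- by apply: bigcup_measurable => k _; exact: measurable_cone.
Qed.

HB.instance Definition _ := isMeasure.Build _ _ _ surface_measure
  surface_measure0 surface_measure_ge0 surface_measure_sigma_additive.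

Let surface_measure_fin : fin_num_fun surface_measure.
Proof.
move=> A mA; rewrite ge0_fin_numE// lte_mul_pinfty ?lee_fin//.
apply: lebesgue_tuple_unit_ball; first exact: measurable_cone.
move=> x [r [s [/andP[r0 r1] _ ->]]] /=.
by rewrite enorm_scale ?ltW// sphere_enorm mulr1.
Qed.

HB.instance Definition _ := Measure_isFinite.Build _ _ _ surface_measure
  surface_measure_fin.

End sphere.

Arguments surface_measure {R n}.

Section functional.
Context {R : realType} {n : nat}.
Implicit Types (p : R) (F G : sphere R n -> R).

(* The library's type LfunType of L^p functions requires 1 <= p, whereas every
   p > 0 is needed here. *)
Definition nonneg_Lp p F :=
  [/\ measurable_fun setT F, forall s, 0 <= F s &
      finite_norm surface_measure p%:E F].

Definition ess_sup_kernel p F G : \bar R :=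
  ess_sup (surface_measure \x surface_measure)%E
    (fun st : sphere R n * sphere R n =>
      (F st.1 * G st.2 * edist st.1 st.2 `^ (2 * n%:R / p))%:E).

End functional.

(* Main.v *)
From HB Require Import structures.
Require Import Defs.
From mathcomp Require Import all_boot all_order all_algebra.
From mathcomp Require Import all_classical all_reals all_analysis.
From mathcomp Require Import hoelder.
From mathcomp Require Import measurable_realfun ess_sup_inf.
From mathcomp Require Import ring lra.

Set Implicit Arguments.
Unset Strict Implicit.
Unset Printing Implicit Defensive.

Import Order.TTheory GRing.Theory Num.Theory.
Import numFieldNormedType.Exports.

Local Open Scope classical_set_scope.
Local Open Scope ring_scope.

(** The functional is conformally invariant, and in stereographic coordinates
it takes a form where the Brunn-Minkowski inequality applies.

Replacing F by its p-th power reduces everything to p = 1: if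
F(s) G(t) |s - t|^(2n) <= 1 almost everywhere on the sphere, then the product of
the integrals of F and G is at most (2^(-n) |S^n|)^2. Stereographic projection
x |-> stereo x turns the surface measure into (2 / (1 + |x|^2))^n dx, and
|stereo x - stereo y|^2 is |x - y|^2 times the conformal factors
2 / (1 + |x|^2) and 2 / (1 + |y|^2). Absorbing the densities into the functions,
the condition becomes f(x) g(y) |x - y|^(2n) <= 1 on R^n, with no weight left
([surface_measure_stereo], [edist_stereo]).

On R^n the functions are replaced by their radial decreasing rearrangements. If
f > a on A and g > b on B, then all differences of points of A and B lie in the
ball of radius (ab)^(-1/(2n)), and Brunn-Minkowski bounds the sum of the radii
of the balls with the volumes of A and B: if the balls of radius alpha and beta
have less volume than A and B, then a b (alpha + beta)^(2n) <= 1
([level_sets_bound]). In other words the rearranged functions f* and g*, as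
functions of the radius, satisfy f*(alpha) g*(beta) (alpha + beta)^(2n) <= 1.

This is a one-dimensional problem. For alpha = exp(-u) and beta = exp(w), the
logarithmic polar densities of f* and g* have a product at most
h((u + w) / 2)^2, where h(z) is proportional to (exp(z) + exp(-z))^(-n). The
one-dimensional Prekopa-Leindler inequality gives the bound by the square of the
integral of h. Since h is the logarithmic polar density of (1 + |x|^2)^(-n),
that integral is 2^(-n) |S^n| ([euclidean_inequality], [surface_measure_setT]).

Constants are extremal because |s - t| <= 2 bounds the essential supremum for
constants from above, while the inequality itself bounds it from below by the
same number. *)

(** * Densities and layer cakes *)

Section density.
Local Open Scope ereal_scope.
Context d1 d2 (X : measurableType d1) (Y : measurableType d2) (R : realType).
Variables (mu : {measure set X -> \bar R}) (nu : {measure set Y -> \bar R}).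
Variables (phi : X -> Y) (w : X -> R).
Hypothesis mphi : measurable_fun setT phi.
Hypothesis mw : measurable_fun setT w.
Hypothesis w0 : forall x, (0 <= w x)%R.
Hypothesis nuE : forall E, measurable E ->
  nu E = \int[mu]_(x in phi @^-1` E) (w x)%:E.

Import HBNNSimple.

(** Both sides agree on indicators by hypothesis, hence on simple functions by
linearity and on all nonnegative functions by monotone convergence. *)
Lemma integral_density (h : Y -> \bar R) : measurable_fun setT h ->
  (forall y, 0 <= h y) -> \int[nu]_y h y = \int[mu]_x (h (phi x) * (w x)%:E).
Proof.
move=> mh h0.
have indE E : measurable E ->
    \int[nu]_y (\1_E y)%:E = \int[mu]_x ((\1_E (phi x))%:E * (w x)%:E).
  move=> mE; rewrite integral_indic// setIT nuE// integral_mkcond.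
  apply: eq_integral => x _; rewrite patchE indicE.
  have -> : (x \in phi @^-1` E) = (phi x \in E) by apply/idP/idP; rewrite !inE.
  by case: (phi x \in E); rewrite ?mul1e ?mul0e.
pose f_ := nnsfun_approx measurableT mh.
have mW : measurable_fun setT (EFin \o w) by exact/measurable_EFinP.
have mphi' n : measurable_fun setT (fun x => (f_ n (phi x))%:E).
  by apply/measurable_EFinP; exact: measurableT_comp.
transitivity (limn (fun n => \int[nu]_y (f_ n y)%:E)).
  rewrite -monotone_convergence//.
  - by apply: eq_integral => y _; apply/esym/cvg_lim => //; exact: cvg_nnsfun_approx.
  - by move=> n; exact/measurable_EFinP/measurable_funP.
  - by move=> n y _; rewrite lee_fin.
  - by move=> y _ m n mn; rewrite lee_fin; exact/lefP/nd_nnsfun_approx.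
rewrite [X in limn X](_ : _ =
    (fun n => \int[mu]_x ((f_ n (phi x))%:E * (w x)%:E))).
  rewrite -monotone_convergence//; last 3 first.
  - by move=> n; exact: emeasurable_funM.
  - by move=> n x _; rewrite mule_ge0// lee_fin.
  - move=> x _ m n mn; rewrite lee_wpmul2r ?lee_fin//.
    exact/lefP/nd_nnsfun_approx.
  apply: eq_integral => x _; apply/cvg_lim => //.
  by apply: cvgeZr => //; exact: cvg_nnsfun_approx.
apply/funext => n.
have fE y : (f_ n y)%:E =
    \sum_(r \in range (f_ n)) (r%:E * (\1_(f_ n @^-1` [set r]) y)%:E).
  by rewrite fimfunE -fsumEFin.
have mpre r : measurable (f_ n @^-1` [set r]) by exact: measurable_sfunP.
have m1 r : measurable_fun setT (fun x => (\1_(f_ n @^-1` [set r]) (phi x))%:E : \bar R).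
  apply/measurable_EFinP.
  by apply: (@measurableT_comp _ _ _ _ _ _ (\1_(f_ n @^-1` [set r]) : Y -> R)) => //; exact: measurable_indic.
under eq_integral do rewrite fE.
rewrite ge0_integral_fsum//; last 2 first.
- by move=> r; apply: emeasurable_funM => //; apply/measurable_EFinP/measurable_indic.
- by move=> r x _; rewrite nnfun_muleindic_ge0.
under [RHS]eq_integral.
  move=> x _; rewrite fE ge0_mule_fsuml; last first.
    by move=> r; rewrite nnfun_muleindic_ge0.
  over.
rewrite ge0_integral_fsum//; last 2 first.
- by move=> r; apply: emeasurable_funM => //; apply: emeasurable_funM.
- by move=> r x _; apply: mule_ge0; [rewrite nnfun_muleindic_ge0|rewrite lee_fin].
apply: eq_fsbigr => r /[!inE] -[y _ yr].
have r0 : (0 <= r)%R by rewrite -yr.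
under [RHS]eq_integral do rewrite -muleA.
have mr : measurable_fun setT (fun y => (\1_(f_ n @^-1` [set r]) y)%:E : \bar R).
  by apply/measurable_EFinP/measurable_indic.
rewrite (@ge0_integralZl _ _ _ nu setT measurableT _ mr)//.
rewrite (@ge0_integralZl _ _ _ mu setT measurableT _ (emeasurable_funM (m1 r) mW))//.
  by rewrite indE.
by move=> x _; rewrite mule_ge0// lee_fin.
Qed.
End density.

Section substitution.
Local Open Scope ereal_scope.
Context (R : realType).
Let mu := @lebesgue_measure R.
Variables (phi w : R -> R).
Hypothesis mphi : measurable_fun setT phi.
Hypothesis mw : measurable_fun setT w.
Hypothesis w0 : forall x, (0 <= w x)%R.

Let nu (E : set (measurableTypeR R)) := \int[mu]_(x in phi @^-1` E) (w x)%:E.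

Let mpre E : measurable E -> measurable (phi @^-1` E).
Proof. by move=> mE; rewrite -[X in measurable X]setTI; exact: mphi. Qed.

Let nu0 : nu set0 = 0.
Proof. by rewrite /nu preimage_set0 integral_set0. Qed.

Let nu_ge0 E : 0 <= nu E.
Proof. by apply: integral_ge0 => x _; rewrite lee_fin. Qed.

Let nu_sigma_additive : semi_sigma_additive nu.
Proof.
move=> F mF tF mUF; rewrite /nu preimage_bigcup ge0_integral_bigcup.
- by apply: (@is_cvg_nneseries R (fun i => nu (F i)) xpredT 0%N) => n _ _; exact: nu_ge0.
- by move=> k; apply: mpre; exact: mF.
- by apply/measurable_EFinP; exact: measurable_funTS.
- by move=> x _; rewrite lee_fin.
- apply/trivIsetP => /= i j _ _ ij; rewrite -preimage_setI.
  by move/trivIsetP : tF => /(_ _ _ _ _ ij) ->//; rewrite preimage_set0.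
Qed.

HB.instance Definition _ := isMeasure.Build _ _ _ nu nu0 nu_ge0 nu_sigma_additive.

(** A change of variables on the line needs to be checked on intervals only:
the right-hand side is a measure in E, and Lebesgue measure is determined by its
values on half-open intervals. *)
Lemma lebesgue_measure_density :
  (forall a b, (a < b)%R ->
     \int[mu]_(x in phi @^-1` `]a, b]) (w x)%:E = (b - a)%:E) ->
  forall E, measurable E -> mu E = \int[mu]_(x in phi @^-1` E) (w x)%:E.
Proof.
move=> H E mE; apply: (@lebesgue_measure_unique _ nu) => //= _ [[a b]] _ <-.
rewrite /nu lebesgue_measure_itv /= lte_fin; case: ltP => ab.
  by rewrite H.
by rewrite set_itv_ge ?preimage_set0 ?integral_set0// -leNgt bnd_simp.
Qed.

End substitution.

Section layer_cake.
Context d (T : measurableType d) (R : realType).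
Variables (m : {sigma_finite_measure set T -> \bar R}) (f : T -> R).
Hypothesis mf : measurable_fun setT f.

Let hypograph : set (T * measurableTypeR R) := [set z | z.2 < f z.1].

Let measurable_hypograph : measurable hypograph.
Proof.
rewrite -[X in measurable X]setTI.
have mf1 : measurable_fun setT (fun z : T * measurableTypeR R => f z.1).
  exact: measurableT_comp.
exact: (@measurable_fun_ltr _ _ R setT (snd : T * measurableTypeR R -> _) _ _ mf1
  measurableT [set true]).
Qed.

Lemma measurable_superlevel (a : R) : measurable [set x | a < f x].
Proof.
rewrite -[X in measurable X]setTI.
exact: (@measurable_fun_ltr _ _ R setT (cst a) f _ _ measurableT [set true]).
Qed.

Lemma measurable_fun_tail : measurable_fun setT (fun a : R => m [set x | a < f x]).
Proof.
rewrite (_ : (fun a => _) = m \o ysection hypograph); last first.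
  apply/funext => a /=; congr (m _).
  by apply/seteqP; split=> x; rewrite /ysection /hypograph /= inE.
exact: measurable_fun_ysection.
Qed.

(** Fubini for the region under the graph of f. *)
Lemma layer_cake : (forall x, 0 <= f x) ->
  (\int[m]_x (f x)%:E =
   \int[@lebesgue_measure R]_(a in `]0%R, +oo[) m [set x | (a < f x)%R])%E.
Proof.
move=> f0.
pose A : set (T * measurableTypeR R) := [set z | 0 < z.2 < f z.1].
have mA : measurable A.
  rewrite (_ : A = [set z | 0 < z.2] `&` hypograph); last first.
    by apply/seteqP; split=> z /=; move/andP.
  apply: measurableI => //; rewrite -[X in measurable X]setTI.
  by apply: (@measurable_fun_ltr _ _ R setT (cst 0) (snd : T * measurableTypeR R -> _) _ _ measurableT [set true]) => //.
have := @indic_fubini_tonelli _ _ _ _ _ m lebesgue_measure A mA.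
rewrite indic_fubini_tonelli_FE// indic_fubini_tonelli_GE//= => E.
transitivity (\int[m]_x lebesgue_measure (xsection A x))%E.
  apply: eq_integral => x _.
  rewrite (_ : xsection A x = `]0, f x[%classic); last first.
    by apply/seteqP; split=> a; rewrite /xsection /A /= ?inE /= ?in_itv /=.
  rewrite lebesgue_measure_itv/= lte_fin.
  by case: ltP => [|fx]; rewrite ?sube0//; congr _%:E; apply/le_anti/andP.
rewrite E [RHS]integral_mkcond; apply: eq_integral => a _.
rewrite patchE; case: ifPn => a0.
  congr (m _); apply/seteqP; split=> x; rewrite /ysection /A /= inE /=.
    by move=> /andP[].
  by move=> ax; rewrite ax andbT; move: a0; rewrite inE /= in_itv/= andbT => ->.
rewrite (_ : ysection _ _ = set0) ?measure0//.
apply/seteqP; split => x //; rewrite /ysection /= inE /A /= => /andP[a0' _].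
by move: a0; rewrite notin_setE; apply; rewrite /= in_itv/= a0'.
Qed.

End layer_cake.

(** * The Brunn-Minkowski inequality on the line *)

Section affine.
Context {R : realType}.
Local Notation mu := (@lebesgue_measure R).

Lemma lebesgue_measure_affine (r c : R) (E : set (measurableTypeR R)) : r != 0 -> measurable E ->
  (mu ((fun z => (r * z + c)%R) @^-1` E) * `|r|%:E = mu E)%E.
Proof.
move=> r0 mE.
have mphi : measurable_fun setT (fun z : R => r * z + c).
  by apply: measurable_funD => //; exact: measurable_funM.
have mpre (F : set (measurableTypeR R)) : measurable F ->
    measurable ((fun z : R => r * z + c) @^-1` F : set (measurableTypeR R)).
  by move=> mF; rewrite -[X in measurable X]setTI; exact: mphi.
rewrite [RHS](@lebesgue_measure_density _ (fun z : R => r * z + c) (cst `|r|))//.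
  by rewrite (integral_cst mu (mpre _ mE) `|r|%:E) muleC.
move=> a b ab; rewrite (integral_cst _ (mpre `]a, b]%classic _) `|r|%:E)//.
have [r0'|r0'] := ltP 0 r.
  rewrite (_ : _ @^-1` _ = `](a - c) / r, (b - c) / r]%classic); last first.
    apply/seteqP; split=> z; rewrite /= !in_itv/= ltr_pdivrMr// ler_pdivlMr//;
    by rewrite ltrBlDr lerBrDr mulrC.
  rewrite /= lebesgue_measure_itv/= lte_fin ltr_pM2r ?invr_gt0// ltrD2r ab.
  by rewrite gtr0_norm// -EFinD -EFinM; congr EFin; field; rewrite gt_eqF.
have {}r0' : r < 0 by rewrite lt_neqAle r0.
rewrite (_ : _ @^-1` _ = `[(b - c) / r, (a - c) / r[%classic); last first.
  apply/seteqP; split=> z; rewrite /= !in_itv/= ler_ndivrMr// ltr_ndivlMr//;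
  by rewrite ltrBlDr lerBrDr mulrC andbC.
rewrite /= lebesgue_measure_itv/= lte_fin ltr_nM2r ?invr_lt0// ltrD2r ab.
by rewrite ltr0_norm// -EFinD -EFinM; congr EFin; field; rewrite lt_eqF.
Qed.

(** A substitute for choosing a maximum of A, which need not exist: the points
of A are cofinal in A, so the left tails cut at points of A exhaust the
measure. *)
Lemma lebesgue_measure_left_tails (A : set (measurableTypeR R)) (M : \bar R) : measurable A ->
  A !=set0 -> (forall a, A a -> (mu (A `&` `]-oo, a]) <= M)%E) ->
  (mu A <= M)%E.
Proof.
move=> mA A0 H.
have mAI (i : interval R) : measurable (A `&` [set` i]) by exact: measurableI.
have [ubA|nubA] := pselect (has_ubound A).
  apply/lee_addgt0Pr => e e0.
  have [a Aa sa] := sup_adherent e0 (conj A0 ubA).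
  pose T : set (measurableTypeR R) := `](sup A - e)%R, sup A]%classic.
  have mT : measurable T by exact: measurable_itv.
  have mAa := mAI `]-oo, a].
  apply: (@le_trans _ _ (mu (A `&` `]-oo, a]) + mu T)%E).
    apply: (@le_trans _ _ (mu ((A `&` `]-oo, a]) `|` T))).
      apply: le_measure; rewrite ?inE//; first exact: measurableU.
      move=> x Ax; have [xa|ax] := leP x a; first by left; rewrite /= in_itv.
      right; rewrite /T /= in_itv/= (lt_trans sa ax)/=.
      exact: ub_le_sup.
    exact: measureU2.
  apply: leeD; first exact: H.
  rewrite lebesgue_measure_itv/= lte_fin ltrBlDr ltrDl e0 -EFinD lee_fin; lra.
have := @nondecreasing_cvg_mu _ _ _ mu (fun n => A `&` `]-oo, n%:R]) (fun n => mAI _) .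
have -> : \bigcup_n (A `&` `]-oo, n%:R]) = A.
  apply/seteqP; split=> x; first by case=> ? _ [].
  move=> Ax; exists (Num.truncn `|x|).+1 => //; split => //=.
  rewrite in_itv/= ltW// (le_lt_trans (ler_norm _))//.
  by rewrite truncnS_gt.
have nd : {homo (fun n => A `&` `]-oo, n%:R]) : n m / (n <= m)%N >-> (n <= m)%O}.
  move=> n m nm; apply/subsetPset => x [Ax]; rewrite /= !in_itv/= => xn.
  by split=> //=; rewrite ?in_itv/= (le_trans xn)// ler_nat.
move=> /(_ mA nd) cv.
rewrite -(cvg_lim _ cv)//; apply: lime_le; first by apply/cvg_ex; eexists; exact: cv.
apply: nearW => n /=.
have [a Aa na] : exists2 a, A a & n%:R <= a.
  apply/not_exists2P => nA; apply: nubA; exists n%:R => a Aa.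
  by have [//|/negP] := nA a; rewrite -ltNge => /ltW.
apply: le_trans (H _ Aa); apply: le_measure; rewrite ?inE//.
move=> x [Ax]; rewrite /= in_itv/= => xn.
by split=> //=; rewrite ?in_itv/= (le_trans xn).
Qed.

Lemma lebesgue_measure_right_tails (A : set (measurableTypeR R)) (M : \bar R) : measurable A ->
  A !=set0 -> (forall a, A a -> (mu (A `&` `[a, +oo[) <= M)%E) ->
  (mu A <= M)%E.
Proof.
move=> mA [a0 Aa0] H; rewrite -lebesgue_measureN//.
have mN (B : set (measurableTypeR R)) : measurable B ->
    measurable ((fun x : R => - x) @^-1` B : set (measurableTypeR R)).
  move=> mB; rewrite -[X in measurable X]setTI.
  have mo : measurable_fun setT (fun x : R => - x) by exact: oppr_measurable.
  exact: mo.
apply: lebesgue_measure_left_tails.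
- exact: mN.
- by exists (- a0); rewrite /= opprK.
move=> a Aa; apply: le_trans (H _ Aa).
rewrite -[leRHS]lebesgue_measureN; last exact: measurableI.
rewrite /pushforward le_eqVlt; apply/orP; left; apply/eqP; congr mu.
by apply/seteqP; split=> x /= [Ax]; rewrite !in_itv/= ?andbT ?lerN2 => xa; split=> //;
  move: xa; rewrite ?in_itv/= ?andbT ?lerN2.
Qed.

(** For a in A and b in B, the set C contains l A + (1 - l) b and
l a + (1 - l) B. When A is cut to the left of a and B to the right of b, these
two copies meet only at the point l a + (1 - l) b, so their measures add up; the
cuts are then removed by exhausting A and B by tails. *)
Lemma brunn_minkowski1 (A B C : set (measurableTypeR R)) (l : R) : 0 < l < 1 ->
  measurable A -> measurable B -> measurable C -> A !=set0 -> B !=set0 ->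
  (forall x y, A x -> B y -> C (l * x + (1 - l) * y)) ->
  (l%:E * mu A + (1 - l)%:E * mu B <= mu C)%E.
Proof.
move=> /andP[l0 l1] mA mB mC A0 B0 ABC.
have l'0 : 0 < 1 - l by rewrite subr_gt0.
have nNy (x : \bar R) : (0 <= x)%E -> x != -oo%E by case: x.
have key a b : A a -> B b ->
    (l%:E * mu (A `&` `]-oo, a]) + (1 - l)%:E * mu (B `&` `[b, +oo[) <= mu C)%E.
  move=> Aa Bb.
  set A' := A `&` _; set B' := B `&` _.
  have mA' : measurable A' by exact: measurableI.
  have mB' : measurable B' by exact: measurableI.
  (* p and q are the inverses of x |-> l x + (1 - l) b and
     y |-> l a + (1 - l) y *)
  pose p := fun z : R => l^-1 * z + - ((1 - l) / l * b).
  pose q := fun z : R => (1 - l)^-1 * z + - (l / (1 - l) * a).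
  have mp : measurable (p @^-1` A' : set (measurableTypeR R)).
    rewrite -[X in measurable X]setTI; suff : measurable_fun setT p by exact.
    by apply: measurable_funD => //; exact: measurable_funM.
  have mq : measurable (q @^-1` B' : set (measurableTypeR R)).
    rewrite -[X in measurable X]setTI; suff : measurable_fun setT q by exact.
    by apply: measurable_funD => //; exact: measurable_funM.
  have pE : (l%:E * mu A' = mu (p @^-1` A'))%E.
    rewrite -(@lebesgue_measure_affine l^-1 (- ((1 - l) / l * b)) A') ?invr_neq0 ?gt_eqF//.
    by rewrite gtr0_norm ?invr_gt0// muleCA -EFinM mulfV ?gt_eqF// mule1.
  have qE : ((1 - l)%:E * mu B' = mu (q @^-1` B'))%E.
    rewrite -(@lebesgue_measure_affine (1 - l)^-1 (- (l / (1 - l) * a)) B') ?invr_neq0 ?gt_eqF//.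
    by rewrite gtr0_norm ?invr_gt0// muleCA -EFinM mulfV ?gt_eqF// mule1.
  rewrite pE qE.
  pose c := l * a + (1 - l) * b.
  have pK z : z = l * p z + (1 - l) * b by rewrite /p; field; rewrite gt_eqF.
  have qK z : z = l * a + (1 - l) * q z by rewrite /q; field; rewrite gt_eqF.
  have pc z : (p @^-1` A') z -> z <= c.
    by move=> -[_]; rewrite {2}(pK z) /c/= in_itv/= => za; rewrite lerD2r ler_pM2l.
  have qc z : (q @^-1` B') z -> c <= z.
    by move=> -[_]; rewrite {2}(qK z) /c/= in_itv/= andbT => za; rewrite lerD2l ler_pM2l.
  apply: (@le_trans _ _ (mu ((p @^-1` A') `|` ((q @^-1` B') `\ c)))).
    rewrite measureU//; first last.
    - apply/seteqP; split=> z // -[/pc zc [/qc cz]]; apply.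
      by apply/le_anti; rewrite zc cz.
    - exact: measurableD.
    apply: leeD => //.
    apply: (@le_trans _ _ (mu ((q @^-1` B' `\ c) `|` [set c]))).
      apply: le_measure; rewrite ?inE//.
        by apply: measurableU => //; exact: measurableD.
      by move=> z Bz; have [->|/eqP zc] := eqVneq z c; [right|left].
    rewrite (le_trans (measureU2 _ _ _))//; first exact: measurableD.
    by rewrite /= lebesgue_measure_set1 adde0.
  apply: le_measure; rewrite ?inE//.
    by apply: measurableU => //; exact: measurableD.
  move=> z [[Ap _]|[[Bq _] _]].
    by rewrite (pK z); exact: ABC.
  by rewrite (qK z); exact: ABC.
have {}key b : B b -> (l%:E * mu A + (1 - l)%:E * mu (B `&` `[b, +oo[) <= mu C)%E.
  move=> Bb.
  have : (0 <= mu (B `&` `[b, +oo[))%E by exact: measure_ge0.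
  case E : (mu _) => [s| |]// _.
    rewrite -EFinM -leeBrDr// -lee_pdivlMl//.
    apply: lebesgue_measure_left_tails => // a Aa.
    by rewrite lee_pdivlMl// leeBrDr// EFinM -E key.
  case: A0 => a Aa; move: (key a b Aa Bb); rewrite E gt0_muley ?lte_fin//.
  by rewrite addey ?leye_eq => [/eqP->|]; rewrite ?leey// nNy// mule_ge0// lee_fin ltW.
have : (0 <= mu A)%E by exact: measure_ge0.
case E : (mu _) => [s| |]// _.
  rewrite addeC -EFinM -leeBrDr// -lee_pdivlMl//.
  apply: lebesgue_measure_right_tails => // b Bb.
  by rewrite lee_pdivlMl// leeBrDr// EFinM -E addeC key.
case: B0 => b Bb; move: (key b Bb); rewrite E gt0_muley ?lte_fin//.
by rewrite addye ?leye_eq => [/eqP->|]; rewrite ?leey// nNy// mule_ge0// lee_fin ltW.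
Qed.

End affine.

(** * The Prekopa-Leindler inequality on the line *)

Section prekopa_leindler.
Context {R : realType}.
Local Notation mu := (@lebesgue_measure R).

(** Young's inequality for the conjugate exponents 1 / l and 1 / (1 - l). *)
Lemma weighted_amgm (l x y : R) : 0 < l < 1 -> 0 <= x -> 0 <= y ->
  x `^ l * y `^ (1 - l) <= l * x + (1 - l) * y.
Proof.
move=> /andP[l0 l1] x0 y0; have l'0 : 0 < 1 - l by rewrite subr_gt0.
have := @conjugate_powR R (x `^ l) (y `^ (1 - l)) l^-1 (1 - l)^-1.
rewrite !powR_ge0 !invr_gt0 !invrK l0 l'0 -!powRrM !mulfV ?gt_eqF// !powRr1//.
by rewrite addrC subrK [x * _]mulrC [y * _]mulrC; exact.
Qed.

(** When f and g both have supremum 1, their level sets at each height t < 1 are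
nonempty, so one-dimensional Brunn-Minkowski applies at every height; integrating
over t gives this additive form, stronger than the multiplicative one. *)
Lemma prekopa_leindler_unit (f g h : R -> R) (l : R) : 0 < l < 1 ->
  measurable_fun setT f -> measurable_fun setT g -> measurable_fun setT h ->
  (forall x, 0 <= f x <= 1) -> (forall x, 0 <= g x <= 1) -> (forall x, 0 <= h x) ->
  (forall t, t < 1 -> exists x, t < f x) ->
  (forall t, t < 1 -> exists x, t < g x) ->
  (forall t x y, 0 < t -> t < f x -> t < g y -> t < h (l * x + (1 - l) * y)) ->
  (l%:E * \int[mu]_x (f x)%:E + (1 - l)%:E * \int[mu]_x (g x)%:E <=
   \int[mu]_x (h x)%:E)%E.
Proof.
move=> l01 mf mg mh f01 g01 h0 f1 g1 fgh; have /andP[l0 l1] := l01.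
have l'0 : 0 < 1 - l by rewrite subr_gt0.
have l0w := ltW l0; have l'0w := ltW l'0.
have m01 : measurable (`]0, +oo[%classic : set R) by [].
rewrite !layer_cake//; last 2 first.
- by move=> x; case/andP : (g01 x).
- by move=> x; case/andP : (f01 x).
rewrite -!ge0_integralZl ?lee_fin//; last 2 first.
- exact: measurable_funTS (measurable_fun_tail mu _).
- exact: measurable_funTS (measurable_fun_tail mu _).
rewrite -ge0_integralD//; last 4 first.
- by move=> x _; rewrite mule_ge0// lee_fin.
- by apply: measurable_funeM; exact: measurable_funTS (measurable_fun_tail mu _).
- by move=> x _; rewrite mule_ge0// lee_fin.
- by apply: measurable_funeM; exact: measurable_funTS (measurable_fun_tail mu _).
apply: ge0_le_integral => //.
- by move=> x _; rewrite adde_ge0// mule_ge0// lee_fin.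
- apply: emeasurable_funD; apply: measurable_funeM; exact: measurable_funTS (measurable_fun_tail mu _).
- exact: measurable_funTS (measurable_fun_tail mu _).
move=> a; rewrite /= in_itv/= andbT => a0.
have [a1|a1] := ltP a 1.
  apply: brunn_minkowski1 => //; try exact: measurable_superlevel;
    try by [exact: f1|exact: g1].
  by move=> x y; exact: fgh.
rewrite (_ : [set x | a < f x] = set0); last first.
  apply/seteqP; split=> x //=; case/andP: (f01 x) => _ fx1.
  by rewrite ltNge (le_trans fx1).
rewrite (_ : [set x | a < g x] = set0); last first.
  apply/seteqP; split=> x //=; case/andP: (g01 x) => _ fx1.
  by rewrite ltNge (le_trans fx1).
by rewrite !measure0 !mule0 add0e.
Qed.


(** Makes it possible to assume the functions bounded. *)
Lemma integral_gt_truncation d (T : measurableType d) (m : {measure set T -> \bar R})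
    (f : T -> \bar R) (I : R) :
  measurable_fun setT f -> (forall x, 0 <= f x)%E ->
  (I%:E < \int[m]_x f x)%E ->
  exists n, (I%:E < \int[m]_x mine (f x) n%:R%:E)%E.
Proof.
move=> mf f0 If; apply: contrapT => /forallNP H; move: If; apply/negP; rewrite -leNgt.
rewrite (_ : \int[m]_x f x = \int[m]_x (limn (fun n => mine (f x) n%:R%:E)))%E.
  rewrite monotone_convergence//.
  - apply: lime_le.
      apply: ereal_nondecreasing_is_cvgn => a b ab.
      apply: ge0_le_integral => //.
      + by move=> x _; rewrite le_min f0 lee_fin/=.
      + by apply: measurable_mine.
      + by apply: measurable_mine.
      + move=> x _; rewrite le_min ge_min lexx/= ge_min lee_fin ler_nat ab orbT//.
    by apply: nearW => n; rewrite leNgt; apply/negP/H.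
  - by move=> n; apply: measurable_mine.
  - by move=> n x _; rewrite le_min f0 lee_fin/=.
  - by move=> x _ a b ab; rewrite le_min ge_min lexx/= ge_min lee_fin ler_nat ab orbT.
apply: eq_integral => x _; apply/esym/cvg_lim => //.
have := f0 x; case: (f x) => [r| |]// r0.
  apply: cvg_near_cst; near=> n; rewrite min_l// lee_fin.
  near: n; exact: nbhs_infty_ger.
under eq_fun do rewrite minye.
by apply/cvgeryP/cvgr_idn.
Unshelve. all: by end_near. Qed.

(** The hypothesis only compares numbers strictly below f x and g y, which makes
sense for infinite values and is what one gets when f and g are themselves
measures of sections. After truncation, f and g are divided by their suprema M
and N, and h by M^l N^(1 - l); the weighted arithmetic-geometric inequality turns
the additive conclusion of the normalized case into the multiplicative one. *)
Lemma prekopa_leindler (f g h : R -> \bar R) (l I J : R) : 0 < l < 1 ->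
  measurable_fun setT f -> measurable_fun setT g -> measurable_fun setT h ->
  (forall x, 0 <= f x)%E -> (forall x, 0 <= g x)%E -> (forall x, 0 <= h x)%E ->
  (forall x y a b, 0 <= a -> 0 <= b -> (a%:E < f x)%E -> (b%:E < g y)%E ->
     ((a `^ l * b `^ (1 - l))%:E <= h (l * x + (1 - l) * y)%R)%E) ->
  0 <= I -> 0 <= J ->
  (I%:E < \int[mu]_x f x)%E -> (J%:E < \int[mu]_x g x)%E ->
  ((I `^ l * J `^ (1 - l))%:E <= \int[mu]_x h x)%E.
Proof.
move=> l01 mf mg mh f0 g0 h0 fgh I0 J0 If Jg.
have /andP[l0 l1] := l01; have l'0 : 0 < 1 - l by rewrite subr_gt0.
have [n In] := @integral_gt_truncation _ _ mu f I mf f0 If.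
have [m Jm] := @integral_gt_truncation _ _ mu g J mg g0 Jg.
have norm (u : R -> \bar R) (k : nat) (K : R) : measurable_fun setT u ->
    (forall x, 0 <= u x)%E -> 0 <= K -> (K%:E < \int[mu]_x mine (u x) k%:R%:E)%E ->
    exists M, exists v : R -> R, [/\ 0 < M, measurable_fun setT v,
      (forall x, 0 <= v x <= 1) /\ (forall t, t < 1 -> exists x, t < v x),
      (forall x t, t < v x -> ((M * t)%:E < u x)%E) &
      ((K / M)%:E <= \int[mu]_x (v x)%:E)%E].
  move=> mu' u0 K0 Ku; pose w x := fine (mine (u x) k%:R%:E).
  have wE x : (w x)%:E = mine (u x) k%:R%:E.
    rewrite fineK// ge0_fin_numE; first by rewrite gt_min ltry orbT.
    by rewrite le_min u0 lee_fin/=.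
  have w0 x : 0 <= w x by rewrite -lee_fin wE le_min u0 lee_fin/=.
  have wk x : w x <= k%:R by rewrite -lee_fin wE ge_min lexx orbT.
  have supw : has_sup (range w).
    by split; [exists (w 0); exists 0|exists k%:R => _ [x _ <-]].
  have wsup x : w x <= sup (range w).
    by apply: ub_le_sup; [case: supw|exists x].
  have mw : measurable_fun setT w.
    by apply: (measurableT_comp (f := fine)) => //; exact: measurable_mine.
  have M0 : 0 < sup (range w).
    rewrite ltNge; apply/negP => M0; move: Ku; apply/negP; rewrite -leNgt.
    rewrite (eq_integral (cst 0%E)) ?integral0 ?lee_fin// => x _.
    rewrite -wE; congr EFin; apply/le_anti; rewrite w0 andbT.
    exact: le_trans (wsup x) M0.
  exists (sup (range w)), (fun x => w x / sup (range w)); split => //.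
  - exact: measurable_funM.
  - split=> [x|t t1]; first by rewrite (divr_ge0 (w0 x) (ltW M0))/= ler_pdivrMr// mul1r.
    have e0 : 0 < sup (range w) * (1 - t) by rewrite mulr_gt0// subr_gt0.
    have [_ [x _ <-]] := sup_adherent e0 supw.
    rewrite (_ : _ - _ = t * sup (range w)); last by ring.
    by move=> tx; exists x; rewrite ltr_pdivlMr.
  - move=> x t; rewrite ltr_pdivlMr// mulrC -lte_fin wE => /lt_le_trans; apply.
    by rewrite ge_min lexx.
  - under eq_integral do rewrite mulrC EFinM.
    rewrite ge0_integralZl//; last 3 first.
    + exact/measurable_EFinP.
    + by move=> x _; rewrite lee_fin.
    + by rewrite lee_fin invr_ge0 ltW.
    rewrite mulrC EFinM lee_pmul2l ?lte_fin ?invr_gt0//.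
    by under eq_integral do rewrite wE; exact: ltW.
have [M [F [M0 mF [F01 F1] Ff IF]]] := norm _ _ _ mf f0 I0 In.
have [N [G [N0 mG [G01 G1] Gg JG]]] := norm _ _ _ mg g0 J0 Jm.
pose P := M `^ l * N `^ (1 - l).
have P0 : 0 < P by rewrite mulr_gt0// powR_gt0.
pose H x := fine (mine (h x) P%:E) / P.
have hfin x : mine (h x) P%:E \is a fin_num.
  rewrite ge0_fin_numE; first by rewrite gt_min ltry orbT.
  by rewrite le_min h0 lee_fin ltW.
have mH : measurable_fun setT H.
  apply: measurable_funM => //; apply: (measurableT_comp (f := fine)) => //.
  exact: measurable_mine.
have H0 x : 0 <= H x.
  by apply: divr_ge0 (ltW P0); apply: fine_ge0; rewrite le_min h0 lee_fin ltW.
have key := prekopa_leindler_unit l01 mF mG mH F01 G01 H0 F1 G1.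
have {}key : (l%:E * \int[mu]_x (F x)%:E + (1 - l)%:E * \int[mu]_x (G x)%:E <=
   \int[mu]_x (H x)%:E)%E.
  apply: key => t x y t0 tF tG.
  (* a height strictly between t and F x, G y turns the weak bound on h into the
     strict one *)
  pose t' := (t + Num.min (1 : R) (Num.min (F x) (G y))) / 2.
  have t1 : t < 1 by apply: lt_le_trans tF _; case/andP : (F01 x).
  have tm : t < Num.min (1 : R) (Num.min (F x) (G y)) by rewrite !lt_min t1 tF.
  have tt' : t < t' by rewrite /t'; lra.
  have : t' < Num.min (1 : R) (Num.min (F x) (G y)) by rewrite /t'; lra.
  rewrite !lt_min => /and3P[t'1 t'F t'G].
  have t'p := lt_trans t0 tt'; have t'0 := ltW t'p.
  apply: lt_le_trans tt' _; rewrite /H ler_pdivlMr// -lee_fin fineK//.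
  rewrite le_min lee_fin ger_pMl// (ltW t'1) andbT.
  have := fgh x y _ _ (mulr_ge0 (ltW M0) t'0) (mulr_ge0 (ltW N0) t'0) (Ff _ _ t'F) (Gg _ _ t'G).
  rewrite (powRM _ (ltW M0) t'0) (powRM _ (ltW N0) t'0) mulrACA -powRD; last first.
    by apply/implyP => _; rewrite gt_eqF.
  by rewrite [l + _]addrC subrK powRr1// mulrC.
have HP : (\int[mu]_x (H x)%:E <= P^-1%:E * \int[mu]_x h x)%E.
  rewrite -ge0_integralZl// ?lee_fin ?invr_ge0 ?(ltW P0)//.
  apply: ge0_le_integral => //.
  - by move=> x _; rewrite lee_fin.
  - exact/measurable_EFinP.
  - by apply: measurable_funeM.
  - move=> x _; rewrite /H mulrC EFinM fineK// lee_pmul2l ?lte_fin ?invr_gt0//.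
    by rewrite ge_min lexx.
have := le_trans key HP; rewrite lee_pdivlMl//; apply: le_trans.
apply: (@le_trans _ _ (P%:E * (l * (I / M) + (1 - l) * (J / N))%:E)%E); last first.
  rewrite lee_pmul2l// EFinD !EFinM; apply: leeD; rewrite lee_pmul2l//.
rewrite -EFinM lee_fin -ler_pdivrMl//.
apply: le_trans (weighted_amgm l01 (divr_ge0 I0 (ltW M0)) (divr_ge0 J0 (ltW N0))).
rewrite !powRM ?invr_ge0 ?(ltW M0) ?(ltW N0)//.
have powRVE (x a : R) : 0 < x -> x^-1 `^ a = (x `^ a)^-1.
  by move=> x0; rewrite -powR_inv1 ?ltW// -powRrM mulN1r powRN.
rewrite !powRVE// le_eqVlt; apply/orP; left; apply/eqP; rewrite /P.
by field; rewrite !gt_eqF// powR_gt0.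
Qed.

End prekopa_leindler.

(** * Sections and scaling of Lebesgue measure *)

Section sections.
Local Open Scope ereal_scope.
Context d1 d2 (T1 : measurableType d1) (T2 : measurableType d2) (R : realType).
Variables (m1 : {sigma_finite_measure set T1 -> \bar R}).
Variables (m2 : {sigma_finite_measure set T2 -> \bar R}).
Variable D : set (T1 * T2).
Hypothesis mD : measurable D.

Lemma xsection_set x : xsection D x = [set y | D (x, y)].
Proof. by apply/seteqP; split=> y; rewrite /xsection /= inE. Qed.

Lemma ysection_set y : ysection D y = [set x | D (x, y)].
Proof. by apply/seteqP; split=> x; rewrite /ysection /= inE. Qed.

Lemma measurable_fun_xset : measurable_fun setT (fun x => m2 [set y | D (x, y)]).
Proof.
have := measurable_fun_xsection m2 mD.
by congr (measurable_fun _ _); apply/funext => z /=; rewrite xsection_set.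
Qed.

Lemma measurable_fun_yset : measurable_fun setT (fun y => m1 [set x | D (x, y)]).
Proof.
have := measurable_fun_ysection m1 mD.
by congr (measurable_fun _ _); apply/funext => z /=; rewrite ysection_set.
Qed.

Lemma tonelli_sections :
  \int[m1]_x m2 [set y | D (x, y)] = \int[m2]_y m1 [set x | D (x, y)].
Proof.
have := indic_fubini_tonelli m1 m2 mD.
rewrite indic_fubini_tonelli_FE// indic_fubini_tonelli_GE// => E.
under eq_integral do rewrite -xsection_set.
by under [RHS]eq_integral do rewrite -ysection_set.
Qed.

End sections.

Section lebesgue_tuple_sections.
Context {R : realType}.
Local Notation mu := (@lebesgue_measure R).
Local Notation L := (@lebesgue_tuple R).
Local Open Scope ereal_scope.

Lemma measurable_cons_preimage n (A : set (n.+1.-tuple R)) : measurable A ->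
  measurable (@cons_pair R n @^-1` A).
Proof.
by move=> mA; rewrite -[X in measurable X]setTI; exact: measurable_cons_pair.
Qed.

Lemma measurable_tuple_xsection n (A : set (n.+1.-tuple R)) (t : R) :
  measurable A -> measurable [set x | A (cons_pair (t, x))].
Proof.
move=> /measurable_cons_preimage mA.
rewrite (_ : [set x | _] = xsection (@cons_pair R n @^-1` A) t).
  exact: measurable_xsection.
by rewrite xsection_set.
Qed.

Lemma measurable_tuple_ysection n (A : set (n.+1.-tuple R)) (x : n.-tuple R) :
  measurable A -> measurable ([set t | A (cons_pair (t, x))] : set (measurableTypeR R)).
Proof.
move=> /measurable_cons_preimage mA.
rewrite (_ : [set t | _] = ysection (@cons_pair R n @^-1` A) x).
  exact: measurable_ysection.
by rewrite ysection_set.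
Qed.

Lemma lebesgue_tuple_xsection n (A : set (n.+1.-tuple R)) : measurable A ->
  L n.+1 A = \int[mu]_t L n [set x | A (cons_pair (t, x))].
Proof.
move=> mA; rewrite /= /lebesgue_cons /pushforward /product_measure1.
by apply: eq_integral => t _ /=; rewrite xsection_set.
Qed.

Lemma lebesgue_tuple_ysection n (A : set (n.+1.-tuple R)) : measurable A ->
  L n.+1 A = \int[L n]_x mu [set t | A (cons_pair (t, x))].
Proof.
move=> mA; rewrite lebesgue_tuple_xsection//.
exact: (tonelli_sections mu (L n) (measurable_cons_preimage mA)).
Qed.

Lemma scale_tuple_cons n (r t : R) (x : n.-tuple R) :
  scale_tuple r (cons_pair (t, x)) = cons_pair ((r * t)%R, scale_tuple r x).
Proof.
apply: eq_from_tnth => i; rewrite !tnth_mktuple.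
case: (unliftP ord0 i) => [j|] ->; last by rewrite !(tnth_nth 0%R).
by rewrite !tnthS tnth_mktuple.
Qed.

Lemma measurable_scale_tuple n (r : R) : measurable_fun setT (@scale_tuple R n r).
Proof.
apply/measurable_fun_tnthP => i.
rewrite (_ : _ \o _ = (fun x : n.-tuple R => r * tnth x i)%R); last first.
  by apply/funext => x /=; rewrite tnth_mktuple.
by apply: measurable_funM => //; exact: measurable_tnth.
Qed.

Lemma measurable_scale_preimage n (r : R) (A : set (n.-tuple R)) :
  measurable A -> measurable (scale_tuple r @^-1` A).
Proof.
by move=> mA; rewrite -[X in measurable X]setTI; exact: measurable_scale_tuple.
Qed.

(** Induction on the dimension, scaling the first coordinate and then the
others; negative r is included because Brunn-Minkowski is applied to A and to a
multiple of - B. *)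
Lemma lebesgue_tuple_scale n (r : R) (A : set (n.-tuple R)) : r != 0%R ->
  measurable A -> L n (scale_tuple r @^-1` A) * (`|r| ^+ n)%:E = L n A.
Proof.
move=> r0; elim: n A => [|n ih] A mA.
  rewrite expr0 mule1; congr (L 0 _).
  by apply/seteqP; split=> x /=; rewrite (tuple0 (scale_tuple r x)) (tuple0 x).
have mrA := measurable_scale_preimage r mA.
pose D : set (measurableTypeR R * n.-tuple R) :=
  [set z | A (cons_pair (z.1, scale_tuple r z.2))].
have mD : measurable D.
  have mc : measurable_fun setT (fun z : measurableTypeR R * n.-tuple R =>
      cons_pair (z.1, scale_tuple r z.2)).
    apply: (measurableT_comp (@measurable_cons_pair R n)).
    apply: measurable_fun_pair => //.
    exact: (measurableT_comp (@measurable_scale_tuple n r)).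
  by rewrite -[X in measurable X]setTI; exact: mc.
transitivity (\int[mu]_t L n [set x | D (t, x)] * (`|r| ^+ n)%:E).
  rewrite lebesgue_tuple_ysection// (tonelli_sections mu (L n) mD) exprS EFinM muleA; congr (_ * _).
  rewrite muleC -ge0_integralZl ?lee_fin//; last first.
    exact: (measurable_fun_yset _ (measurable_cons_preimage mrA)).
  apply: eq_integral => x _.
  have mDx : measurable ([set t | D (t, x)] : set (measurableTypeR R)).
    by rewrite -ysection_set; exact: measurable_ysection.
  apply: etrans (lebesgue_measure_affine 0%R r0 mDx).
  rewrite muleC; congr (_ * _); congr mu; apply/seteqP; split=> t /=;
  by rewrite /D /= scale_tuple_cons addr0.
rewrite lebesgue_tuple_xsection// muleC -ge0_integralZl ?lee_fin//; last first.
  exact: (measurable_fun_xset _ mD).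
apply: eq_integral => t _; by rewrite muleC -(ih _ (measurable_tuple_xsection t mA)).
Qed.

End lebesgue_tuple_sections.

(** * The Brunn-Minkowski inequality and balls *)

Section brunn_minkowski.
Context {R : realType}.
Local Notation mu := (@lebesgue_measure R).
Local Notation L := (@lebesgue_tuple R).

Definition mix_tuple n (l : R) (x y : n.-tuple R) : n.-tuple R :=
  [tuple l * tnth x i + (1 - l) * tnth y i | i < n].

Lemma mix_tuple_cons n (l s t : R) (x y : n.-tuple R) :
  mix_tuple l (cons_pair (s, x)) (cons_pair (t, y)) =
  cons_pair (l * s + (1 - l) * t, mix_tuple l x y).
Proof.
apply: eq_from_tnth => i; rewrite !tnth_mktuple.
case: (unliftP ord0 i) => [j|] ->; last by rewrite !(tnth_nth 0%R).
by rewrite !tnthS tnth_mktuple.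
Qed.

(** The multiplicative form passes to products: the section of C at
l s + (1 - l) t contains the mixture of the sections of A at s and of B at t, so
by induction the measures of the sections satisfy the hypothesis of the
one-dimensional Prekopa-Leindler inequality. *)
Lemma brunn_minkowski n (A B C : set (n.-tuple R)) (l a b : R) : 0 < l < 1 ->
  measurable A -> measurable B -> measurable C ->
  (forall x y, A x -> B y -> C (mix_tuple l x y)) ->
  0 <= a -> 0 <= b -> (a%:E < L n A)%E -> (b%:E < L n B)%E ->
  ((a `^ l * b `^ (1 - l))%:E <= L n C)%E.
Proof.
move=> l01; have /andP[l0 l1] := l01.
have l'0 : 0 < 1 - l by rewrite subr_gt0.
elim: n A B C a b => [|n ih] A B C a b mA mB mC ABC a0 b0 aA bB.
  have nonempty (D : set (0.-tuple R)) (d : R) : 0 <= d -> (d%:E < L 0 D)%E ->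
      D [tuple] /\ d <= 1.
    move=> d0; rewrite /= diracE; have [/set_mem D0|_] := boolP (_ \in D).
      by rewrite lte_fin => /ltW.
    by rewrite lte_fin => /(le_lt_trans d0); rewrite ltxx.
  have [A0 a1] := nonempty _ _ a0 aA.
  have [B0 b1] := nonempty _ _ b0 bB.
  have C0 := ABC _ _ A0 B0.
  rewrite /= diracE mem_set; last by rewrite (tuple0 (mix_tuple _ _ _)) in C0.
  have le1 (d s : R) : 0 < s -> 0 <= d -> d <= 1 -> d `^ s <= 1.
    move=> s0 d0 d1; rewrite (_ : 1 = 1 `^ s); last by rewrite powR1.
    by apply: ge0_ler_powR; rewrite ?nnegrE// ltW.
  by rewrite lee_fin mulr_ile1 ?powR_ge0 ?le1.
rewrite lebesgue_tuple_xsection// in aA; rewrite lebesgue_tuple_xsection// in bB.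
rewrite lebesgue_tuple_xsection//.
apply: (prekopa_leindler l01 _ _ _ _ _ _ _ a0 b0 aA bB) => //.
- exact: (measurable_fun_xset (L n) (measurable_cons_preimage mA)).
- exact: (measurable_fun_xset (L n) (measurable_cons_preimage mB)).
- exact: (measurable_fun_xset (L n) (measurable_cons_preimage mC)).
move=> s t a' b' a'0 b'0 a'A b'B.
apply: ih a'A b'B => //; try exact: measurable_tuple_xsection.
by move=> x y /= Ax By; rewrite -mix_tuple_cons; exact: ABC.
Qed.

End brunn_minkowski.

Section balls.
Context {R : realType}.
Local Notation L := (@lebesgue_tuple R).

Lemma lebesgue_tuple_setT_gt0 n : (0 < L n setT)%E.
Proof.
elim: n => [|n ih]; first by rewrite /= diracE mem_set// lte_fin.
rewrite lebesgue_tuple_xsection//= integral_cst//=.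
rewrite mule_gt0//; apply: (@lt_le_trans _ _ (lebesgue_measure (`[0, 1]%classic : set R))).
  by rewrite lebesgue_measure_itv/= lte01 oppr0 adde0 lte_fin.
by apply: le_measure; rewrite ?inE.
Qed.

Definition ball_volume n : R := fine (L n [set x | enorm x < 1]).

Lemma measurable_enorm_lt n (r : R) : measurable [set x : n.-tuple R | enorm x < r].
Proof.
rewrite -[X in measurable X]setTI.
exact: (@measurable_fun_ltr _ _ R setT (@enorm R n) (cst r) (@measurable_enorm R n) _
  measurableT [set true]).
Qed.

Lemma measurable_enorm_le n (r : R) : measurable [set x : n.-tuple R | enorm x <= r].
Proof.
rewrite -[X in measurable X]setTI.
exact: (@measurable_fun_ler _ _ R setT (@enorm R n) (cst r) (@measurable_enorm R n) _
  measurableT [set true]).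
Qed.

(** Scaling of the unit ball, whose volume is never computed. *)
Lemma lebesgue_open_ball n (r : R) : 0 < r ->
  L n [set x | enorm x < r] = (ball_volume n * r ^+ n)%:E.
Proof.
move=> r0; rewrite -(@lebesgue_tuple_scale _ n r)// ?gt_eqF//; last first.
  exact: measurable_enorm_lt.
rewrite EFinM gtr0_norm//; congr (_ * _)%E; rewrite fineK.
  congr (L n _); apply/seteqP; split=> x /=; rewrite enorm_scale ?ltW//;
  by rewrite gtr_pMr.
rewrite ge0_fin_numE//; apply: lebesgue_tuple_unit_ball => //.
exact: measurable_enorm_lt.
Qed.

(** Otherwise all balls, which cover the space, would be negligible. *)
Lemma ball_volume_gt0 n : 0 < ball_volume n.
Proof.
rewrite lt_neqAle fine_ge0// andbT; apply/eqP => /esym V0.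
have := lebesgue_tuple_setT_gt0 n; apply/negP; rewrite -leNgt.
have H (k : nat) : L n [set x | enorm x < k.+1%:R] = 0%E.
  by rewrite lebesgue_open_ball// V0 mul0r.
have sub : [set: n.-tuple R] `<=` \bigcup_k [set x | enorm x < k.+1%:R].
  by move=> x _; exists (Num.truncn (enorm x)) => //=; exact: truncnS_gt.
have := @measure_sigma_subadditive _ _ _ (L n) _ _
  (fun k => @measurable_enorm_lt n k.+1%:R) measurableT sub.
by rewrite eseries0 => [//|k _ _]; exact: H.
Qed.

(** The closed ball is contained in slightly larger open balls. *)
Lemma lebesgue_closed_ball n (r : R) : 0 < r ->
  (L n [set x | (enorm x <= r)%R] <= (ball_volume n * r ^+ n)%:E)%E.
Proof.
move=> r0; apply/lee_addgt0Pr => e e0.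
have cvg : ball_volume n * s ^+ n @[s --> r^'+] --> ball_volume n * r ^+ n.
  apply: (@cvg_at_right_filter _ _ (fun s => ball_volume n * s ^+ n)).
  by apply: cvgM; [exact: cvg_cst|exact: exprn_continuous].
have /cvgrPdist_lt/(_ _ e0) H := cvg.
have [s [rs se]] : exists s, r < s /\ `|ball_volume n * r ^+ n - ball_volume n * s ^+ n| < e.
  near (r^'+) => s; exists s; split; first by near: s; exact: nbhs_right_gt.
  by near: s.
apply: (@le_trans _ _ (L n [set x | enorm x < s])).
  apply: le_measure; rewrite ?inE.
  - exact: measurable_enorm_le.
  - exact: measurable_enorm_lt.
  by move=> x /= xr; exact: le_lt_trans rs.
rewrite lebesgue_open_ball; last exact: lt_trans rs.
rewrite -EFinD lee_fin; move: se; rewrite ltr_norml; lra.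
Unshelve. all: by end_near. Qed.

Lemma lebesgue_tuple_set0 n : (0 < n)%N -> L n [set x | enorm x = 0] = 0%E.
Proof.
move=> n0; have m0 : measurable [set x : n.-tuple R | enorm x = 0].
  rewrite (_ : [set x | _] = [set x | enorm x <= 0]); first exact: measurable_enorm_le.
  apply/seteqP; split=> x /=; first by move->.
  by move=> x0; apply/le_anti; rewrite x0 enorm_ge0.
apply/le_anti; rewrite measure_ge0 andbT.
apply/lee_addgt0Pr => e e0; rewrite add0e.
pose V := ball_volume n.
pose r := Num.min 1 (e / V).
have V0 : 0 < V := ball_volume_gt0 n.
have r0 : 0 < r by rewrite lt_min ltr01 divr_gt0.
apply: (@le_trans _ _ (L n [set x | enorm x < r])).
  apply: le_measure; rewrite ?inE//; first exact: measurable_enorm_lt.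
  by move=> x /= ->.
rewrite lebesgue_open_ball// lee_fin -/V mulrC -ler_pdivlMr//.
apply: (@le_trans _ _ r); last by rewrite /r ge_min lexx orbT.
rewrite -(prednK n0) exprS ger_pMr// exprn_ile1 ?(ltW r0)//.
by rewrite /r ge_min lexx.
Qed.

End balls.

(** * Level sets of a pair of functions *)

Section level_sets_bound.
Context {R : realType}.
Local Notation L := (@lebesgue_tuple R).

(** A countable base of the topology of R^n. *)
Let rbox n (q : n.-tuple (rat * rat)) : set (n.-tuple R) :=
  [set x | forall i, ratr (tnth q i).1 < tnth x i < ratr (tnth q i).2].

Let measurable_rbox n (q : n.-tuple (rat * rat)) : measurable (rbox q).
Proof.
rewrite (_ : rbox q = \bigcap_(i in [set: 'I_n])
    ((fun x : n.-tuple R => tnth x i) @^-1`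
      `]ratr (tnth q i).1, ratr (tnth q i).2[)); last first.
  apply/seteqP; split=> x /= xq i.
    by move=> _; rewrite /= in_itv/=; exact: xq.
  by have := xq i Logic.I; rewrite /= in_itv.
apply: fin_bigcap_measurable => // i _.
by rewrite -[X in measurable X]setTI; exact: measurable_tnth.
Qed.

(** Discarding the parts of A in the countably many rational boxes that meet A in
a null set costs nothing in measure, and leaves only points near which A has
positive measure. This converts almost everywhere information into information
at every point. *)
Lemma essential_part n (A : set (n.-tuple R)) : measurable A ->
  exists A', [/\ measurable A', A' `<=` A, (L n A <= L n A')%E &
    forall x (e : R), A' x -> 0 < e ->
      exists2 Q, measurable Q & (0 < L n (A `&` Q))%E /\
        (forall y i, Q y -> `|tnth x i - tnth y i| < e)].
Proof.
move=> mA.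
have mAQ q : measurable (A `&` rbox q) by exact: measurableI.
pose N (k : nat) := if unpickle k is Some q then
  if L n (A `&` rbox q) == 0%E then A `&` rbox q else set0 else set0.
have mN k : measurable (N k).
  by rewrite /N; case: unpickle => // q; case: ifP.
have N0 k : L n (N k) = 0%E.
  by rewrite /N; case: unpickle => [q|]; [case: ifP => [/eqP|_]|]; rewrite ?measure0.
have mUN : measurable (\bigcup_k N k) by exact: bigcup_measurable.
have UN0 : L n (\bigcup_k N k) = 0%E.
  have := @measure_sigma_subadditive _ _ _ (L n) _ _ mN mUN (@subset_refl _ _).
  rewrite eseries0; last by move=> k _ _; exact: N0.
  by move=> h; apply/le_anti; rewrite h measure_ge0.
have mA' : measurable (A `\` \bigcup_k N k) by exact: measurableD.
exists (A `\` \bigcup_k N k); split=> //.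
- apply: (@le_trans _ _ (L n ((A `\` \bigcup_k N k) `|` \bigcup_k N k))).
    apply: le_measure; rewrite ?inE//; first exact: measurableU.
    by move=> x Ax; have [Nx|nNx] := pselect ((\bigcup_k N k) x); [right|left].
  by apply: (le_trans (measureU2 _ _ _)) => //; rewrite [X in (_ + X)%E]UN0 adde0.
move=> x e [Ax nNx] e0.
have /choice[q qP] : forall i : 'I_n, exists q : rat * rat,
    tnth x i - e < ratr q.1 < tnth x i /\ tnth x i < ratr q.2 < tnth x i + e.
  move=> i.
  have /rat_in_itvoo[q1 q1P] : tnth x i - e < tnth x i by rewrite ltrBlDr ltrDl.
  have /rat_in_itvoo[q2 q2P] : tnth x i < tnth x i + e by rewrite ltrDl.
  by exists (q1, q2); move: q1P q2P; rewrite !in_itv.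
pose Q := [tuple q i | i < n].
have Qx : rbox Q x.
  by move=> i; rewrite tnth_mktuple; have [/andP[_ ->] /andP[-> _]] := qP i.
exists (rbox Q); first exact: measurable_rbox.
split.
  rewrite lt_neqAle measure_ge0 andbT eq_sym; apply/eqP => Q0; apply: nNx.
  by exists (pickle Q) => //; rewrite /N pickleK Q0 eqxx.
move=> y i /(_ i); rewrite tnth_mktuple.
have [/andP[a1 a2] /andP[a3 a4]] := qP i.
by move=> /andP[a5 a6]; rewrite ltr_norml; apply/andP; split; lra.
Qed.

Let sqdist n (x y : n.-tuple R) := \sum_(i < n) (tnth x i - tnth y i) ^+ 2.

Let edist_sqr n (x y : n.-tuple R) : Defs.edist x y ^+ 2 = sqdist x y.
Proof. by rewrite sqr_sqrtr// sumr_ge0// => i _; exact: sqr_ge0. Qed.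

Lemma nth_root (c : R) n : (0 < n)%N -> 0 < c -> exists2 r, 0 < r & r ^+ n = c.
Proof.
move=> n0 c0; exists (c `^ n%:R^-1); first exact: powR_gt0.
by rewrite -powR_mulrn ?powR_ge0// -powRrM mulVf ?powRr1 ?ltW// pnatr_eq0 -lt0n.
Qed.

(** Arbitrarily close to points x and y of the essential parts there is a pair
that satisfies the bound, and the distance is continuous. *)
Lemma essential_dist n (A B : set (n.-tuple R)) (r : R) :
  measurable A -> measurable B ->
  (forall A0 B0, measurable A0 -> measurable B0 -> A0 `<=` A -> B0 `<=` B ->
    (0 < L n A0)%E -> (0 < L n B0)%E ->
    exists x y, [/\ A0 x, B0 y & Defs.edist x y ^+ 2 <= r]) ->
  exists A' B', [/\ measurable A', measurable B', (L n A <= L n A')%E,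
    (L n B <= L n B')%E & forall x y, A' x -> B' y -> Defs.edist x y ^+ 2 <= r].
Proof.
move=> mA mB H.
have [A' [mA' AA' LA essA]] := essential_part mA.
have [B' [mB' BB' LB essB]] := essential_part mB.
exists A', B'; split=> // x y Ax By; rewrite leNgt; apply/negP => rd.
pose S := \sum_(i < n) `|tnth x i - tnth y i|.
have S0 : 0 <= S by apply: sumr_ge0.
(* moving each coordinate of x and y by less than e changes the squared distance
   downwards by at most 4 e S, which is less than the gap to r *)
pose e := (Defs.edist x y ^+ 2 - r) / (4 * (S + 1)).
have e0 : 0 < e by rewrite divr_gt0 ?subr_gt0// mulr_gt0// ltr_wpDl.
have [P mP [P0 Pe]] := essA _ _ Ax e0.
have [Q mQ [Q0 Qe]] := essB _ _ By e0.
have [] := H (A `&` P) (B `&` Q) _ _ _ _ P0 Q0; try exact: measurableI.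
- exact: subIsetl.
- exact: subIsetl.
move=> x1 [y1 [[_ Px1] [_ Qy1]]]; apply/negP; rewrite -ltNge.
apply: (@lt_le_trans _ _ (Defs.edist x y ^+ 2 - 4 * e * S)).
  have eE : 4 * e * (S + 1) = Defs.edist x y ^+ 2 - r.
    by rewrite /e; field; rewrite lt0r_neq0// ltr_wpDl.
  have : 4 * e * S < Defs.edist x y ^+ 2 - r by rewrite -eE ltr_pM2l ?ltrDl// mulr_gt0.
  lra.
rewrite !edist_sqr /sqdist /S mulr_sumr -sumrB; apply: ler_sum => i _.
have := Pe _ i Px1; have := Qe _ i Qy1.
move: (tnth x i) (tnth x1 i) (tnth y i) (tnth y1 i) => a b c d.
rewrite !ltr_norml => /andP[h1 h2] /andP[h3 h4].
pose u := a - c; pose v := b - d; rewrite -/u -/v.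
have uv : `|u - v| <= 2 * e by rewrite ler_norml /u /v; apply/andP; split; lra.
have : u * (u - v) <= `|u| * (2 * e).
  apply: le_trans (ler_norm _) _; rewrite normrM; exact: ler_wpM2l.
have : 0 <= (u - v) ^+ 2 by exact: sqr_ge0.
by move: (`|u|) => w; nra.
Qed.

(** Let A and B be the level sets, R the bound on their mutual distances, so that
a b R^(2n) = 1. The sets A / al and - B / be have more volume than the unit ball,
and so does their mixture with weights al / (al + be) and be / (al + be) by
Brunn-Minkowski; but this mixture is (A - B) / (al + be), contained in the ball
of radius R / (al + be). *)
Lemma level_sets_bound n (f g : n.-tuple R -> R) (a b al be : R) : (0 < n)%N ->
  measurable_fun setT f -> measurable_fun setT g ->
  (forall A B, measurable A -> measurable B -> (0 < L n A)%E -> (0 < L n B)%E ->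
    exists x y, [/\ A x, B y & f x * g y * Defs.edist x y ^+ (2 * n) <= 1]) ->
  0 < a -> 0 < b -> 0 < al -> 0 < be ->
  ((ball_volume n * al ^+ n)%:E < L n [set x | (a < f x)%R])%E ->
  ((ball_volume n * be ^+ n)%:E < L n [set x | (b < g x)%R])%E ->
  a * b * (al + be) ^+ (2 * n) <= 1.
Proof.
move=> n0 mf mg H a0 b0 al0 be0 fa gb.
have ab0 : 0 < a * b by rewrite mulr_gt0.
have [r r0 rab] : exists2 r, 0 < r & r ^+ n = (a * b)^-1.
  by apply: nth_root => //; rewrite invr_gt0.
have [rt rt0 rtr] := nth_root (n := 2) isT r0.
have mA := measurable_superlevel mf a.
have mB := measurable_superlevel mg b.
have [A [B [{}mA {}mB fA gB AB]]] : exists A' B', [/\ measurable A', measurable B',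
    (L n [set x | (a < f x)%R] <= L n A')%E, (L n [set x | (b < g x)%R] <= L n B')%E &
    forall x y, A' x -> B' y -> Defs.edist x y ^+ 2 <= r].
  apply: essential_dist => // A0 B0 mA0 mB0 A0f B0g A00 B00.
  have [x [y [Ax By xy]]] := H _ _ mA0 mB0 A00 B00.
  exists x, y; split=> //.
  rewrite -(@ler_pXn2r _ n)// ?nnegrE ?(ltW r0) ?sqr_ge0// rab -exprM.
  rewrite -[leRHS]mul1r ler_pdivlMr// mulrC.
  apply: le_trans xy; rewrite ler_wpM2r ?exprn_ge0 ?sqrtr_ge0//.
  by apply: ler_pM; rewrite ?ltW//; [exact: A0f|exact: B0g].
have {}fA := lt_le_trans fa fA; have {}gB := lt_le_trans gb gB.
have V0 := @ball_volume_gt0 R n.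
have s0 : 0 < al + be by rewrite addr_gt0.
have vol (D : set (n.-tuple R)) (c d : R) : measurable D -> 0 < c -> `|d| = c ->
    ((ball_volume n * c ^+ n)%:E < L n D)%E ->
    ((ball_volume n)%:E < L n (scale_tuple d @^-1` D))%E.
  move=> mD c0 dc; have d0 : d != 0 by rewrite -normr_gt0 dc.
  rewrite -(lebesgue_tuple_scale d0 mD) dc EFinM lte_pmul2r//.
  by rewrite lte_fin exprn_gt0.
have A1 := vol A al al mA al0 (gtr0_norm al0) fA.
have B1 : ((ball_volume n)%:E < L n (scale_tuple (- be)%R @^-1` B))%E.
  by apply: (vol B be) => //; rewrite normrN gtr0_norm.
have l01 : 0 < al / (al + be) < 1.
  by rewrite divr_gt0//= ltr_pdivrMr// mul1r ltrDl.
have := @brunn_minkowski R n _ _ [set z | enorm z <= rt / (al + be)] _ _ _ l01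
  (measurable_scale_preimage al mA) (measurable_scale_preimage (- be)%R mB)
  (@measurable_enorm_le _ _ _) _ (ltW V0) (ltW V0) A1 B1.
have -> : ball_volume n `^ (al / (al + be)) * ball_volume n `^ (1 - al / (al + be)) =
    ball_volume n :> R.
  rewrite -powRD; last by apply/implyP => _; rewrite gt_eqF.
  by rewrite [_ + (1 - _)]addrC subrK powRr1// ltW.
move=> BM.
have : ((ball_volume n)%:E <= (ball_volume n * (rt / (al + be)) ^+ n)%:E :> \bar R)%E.
  apply: le_trans (lebesgue_closed_ball n (divr_gt0 rt0 s0)).
  apply: BM => x y /= Ax By.
  rewrite -(@ler_pXn2r _ 2)// ?nnegrE ?enorm_ge0 ?(ltW (divr_gt0 rt0 s0))//.
  rewrite expr_div_n rtr ler_pdivlMr ?exprn_gt0//.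
  apply: le_trans (AB _ _ Ax By).
  rewrite edist_sqr /sqdist /enorm sqr_sqrtr; last first.
    by apply: sumr_ge0 => i _; exact: sqr_ge0.
  rewrite mulr_suml le_eqVlt; apply/orP; left; apply/eqP; apply: eq_bigr => i _.
  rewrite !tnth_mktuple; field; exact: lt0r_neq0.
rewrite lee_fin -[leLHS]mulr1 ler_pM2l// expr_div_n ler_pdivlMr ?exprn_gt0// mul1r.
move=> h; rewrite mulrC -ler_pdivlMr// mul1r -rab mulnC exprM -rtr -!exprM [(2 * n)%N]mulnC !exprM.
by rewrite ler_pXn2r// nnegrE exprn_ge0// ltW.
Qed.

End level_sets_bound.

(** * Logarithmic polar profiles *)

Section radial.
Context {R : realType}.
Local Notation mu := (@lebesgue_measure R).
Local Notation L := (@lebesgue_tuple R).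

Lemma integral_exp_tail (k c x0 : R) : 0 < k -> 0 < c ->
  (\int[mu]_(x in `[x0, +oo[) (k * c * expR (- (k * x)))%:E = (c * expR (- (k * x0)))%:E)%E.
Proof.
move=> k0 c0; pose F (x : R) := - (c * expR (- (k * x))).
have dF x : is_derive (x : R) (1 : R) F (k * c * expR (- (k * x))).
  by apply: is_derive_eq; rewrite /GRing.scale/=; ring.
have cf : continuous (fun x : R => k * c * expR (- (k * x))).
  move=> x; apply: cvgM; first exact: cvg_cst.
  apply: (@continuous_comp _ _ _ (fun x => - (k * x)) expR); last exact: continuous_expR.
  by apply: cvgN; apply: cvgM; [exact: cvg_cst|exact: cvg_id].
have cF : continuous F.
  by move=> x; apply/differentiable_continuous/derivable1_diffP; case: (dF x).
rewrite (@ge0_continuous_FTC2y R _ F x0 0).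
- by rewrite add0e /F EFinN oppeK.
- by move=> x _; rewrite !mulr_ge0 ?expR_ge0 ?ltW.
- exact: continuous_subspaceT.
- rewrite -oppr0 /F; apply: cvgN; rewrite -[X in _ --> X](mulr0 c).
  apply: cvgM; first exact: cvg_cst.
  apply: (@cvg_comp _ _ _ (fun z : R => k * z) (fun z => expR (- z)) _ (pinfty_nbhs R)).
    exact: gt0_cvgMry.
  exact: cvgr_expR.
- by move=> x _; case: (dF x).
- exact/cvg_at_right_filter/cF.
- by move=> x _; rewrite derive1E; case: (dF x).
Qed.

(** The derivative of r |-> V r^k is integrated over the radii r where V r^k < c,
in the variable r = exp(-u). *)
Lemma integral_exp_sublevel (k V : R) (c : \bar R) : 0 < k -> 0 < V -> (0 <= c)%E ->
  (\int[mu]_u ((k * V * expR (- (k * u)))%:E *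
      (\1_[set u : R | ((V * expR (- (k * u)))%:E < c)%E] u)%:E) = c)%E.
Proof.
move=> k0 V0 c0.
have w0 u : 0 <= k * V * expR (- (k * u)) by rewrite !mulr_ge0 ?expR_ge0 ?ltW.
have mw : measurable_fun setT (fun u : R => k * V * expR (- (k * u))).
  apply: measurable_funM => //; apply: (measurableT_comp (f := expR)) => //.
  by apply: measurable_funN; exact: measurable_funM.
have E (S : set (measurableTypeR R)) : measurable S -> (\int[mu]_u ((k * V * expR (- (k * u)))%:E *
    (\1_S u)%:E) = \int[mu]_(u in S) (k * V * expR (- (k * u)))%:E)%E.
  move=> mS; rewrite [RHS]integral_mkcond; apply: eq_integral => u _.
  by rewrite patchE indicE; case: (u \in S); rewrite ?mule1 ?mule0.
have [->|cn0] := eqVneq c 0%E.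
  rewrite (_ : [set u | _] = set0); last first.
    apply/seteqP; split=> u //=; rewrite lte_fin ltNge.
    by rewrite mulr_ge0 ?expR_ge0 ?ltW.
  by rewrite E// integral_set0.
have {}c0 : (0 < c)%E by rewrite lt0e cn0.
case: c c0 cn0 => [r| |]//; rewrite ?lte_fin => r0 _.
  have sub u : (V * expR (- (k * u)) < r) = (- (ln (r / V) / k) < u).
    rewrite mulrC -ltr_pdivlMr// -[ltRHS]lnK ?posrE ?divr_gt0// ltr_expR.
    by rewrite ltrNl -ltr_pdivrMl// mulrN mulrC.
  rewrite (_ : [set u | _] = `]- (ln (r / V) / k), +oo[%classic); last first.
    by apply/seteqP; split=> u /=; rewrite lte_fin in_itv/= andbT sub.
  rewrite E// integral_itv_obnd_cbnd; last exact/measurable_EFinP/measurable_funTS.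
  rewrite integral_exp_tail//; congr EFin; rewrite mulrN opprK mulrCA mulfV ?gt_eqF// mulr1.
  by rewrite lnK ?posrE ?divr_gt0// mulrC divfK// gt_eqF.
rewrite (_ : [set u | _] = setT); last first.
  by apply/seteqP; split=> u //= _; rewrite ltry.
rewrite E//; apply/eqyP => r {}r0.
apply: (@le_trans _ _ (\int[mu]_(u in `[(- (ln (r / V) / k))%R, +oo[) (k * V * expR (- (k * u)))%:E)%E).
  rewrite integral_exp_tail// mulrN opprK mulrCA mulfV ?gt_eqF// mulr1.
  by rewrite lnK ?posrE ?divr_gt0// mulrC divfK// gt_eqF.
apply: ge0_subset_integral => //; first exact/measurable_EFinP.
by move=> u _; rewrite lee_fin.
Qed.


(** For r = exp(-u), the measure of the set of heights a at which the level set
of f is larger than the ball of radius r is the value at radius r of the radial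
decreasing rearrangement of f; the weight n V r^n is the polar density r^(n-1) dr
in the logarithmic variable. *)
Definition radial_profile n (f : n.-tuple R -> R) (u : R) : \bar R :=
  ((n%:R * ball_volume n * expR (- (n%:R * u)))%:E *
    mu [set a : R | (0 < a)%R /\
      ((ball_volume n * expR (- (n%:R * u)))%:E < L n [set x | (a < f x)%R])%E])%E.

Let D n (f : n.-tuple R -> R) : set (measurableTypeR R * measurableTypeR R) :=
  [set z | 0 < z.1 /\
    ((ball_volume n * expR (- (n%:R * z.2)))%:E < L n [set x | (z.1 < f x)%R])%E].

Let measurable_weight (k c : R) : measurable_fun setT (fun u : R => c * expR (- (k * u))).
Proof.
apply: measurable_funM => //; apply: (measurableT_comp (f := expR)) => //.
by apply: measurable_funN; exact: measurable_funM.
Qed.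

Let measurable_D n (f : n.-tuple R -> R) : measurable_fun setT f -> measurable (D f).
Proof.
move=> mf.
have m1 : measurable_fun setT (fun z : measurableTypeR R * measurableTypeR R =>
    (ball_volume n * expR (- (n%:R * z.2)))%:E).
  apply/measurable_EFinP.
  exact: (measurableT_comp (measurable_weight n%:R (ball_volume n)) measurable_snd).
have m2 : measurable_fun setT (fun z : measurableTypeR R * measurableTypeR R =>
    L n [set x | z.1 < f x]).
  exact: (measurableT_comp (measurable_fun_tail (L n) mf) measurable_fst).
apply: measurableI; rewrite -[X in measurable X]setTI.
  by apply: (@measurable_fun_ltr _ _ R setT (cst 0) (fst : measurableTypeR R * measurableTypeR R -> _) _ _ measurableT [set true]) => //.
have mlt := measurable_fun_lte m1 m2.
exact: (mlt measurableT [set true]).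
Qed.

Lemma measurable_radial_profile n (f : n.-tuple R -> R) : measurable_fun setT f ->
  measurable_fun setT (radial_profile f).
Proof.
move=> mf; apply: emeasurable_funM; last first.
  exact: (measurable_fun_yset mu (measurable_D mf)).
by apply/measurable_EFinP; exact: measurable_weight.
Qed.

Lemma measurable_radial_levels n (f : n.-tuple R -> R) (u : R) : measurable_fun setT f ->
  measurable ([set a : R | 0 < a /\
    ((ball_volume n * expR (- (n%:R * u)))%:E < L n [set x | (a < f x)%R])%E]
    : set (measurableTypeR R)).
Proof.
move=> mf; rewrite (_ : [set a | _] = ysection (D f) u); last by rewrite ysection_set.
exact: measurable_ysection (measurable_D mf).
Qed.

(** Rearrangement preserves the integral: both sides are the integral over the
heights a of the measure of the level set of f at height a. *)
Lemma integral_radial_profile n (f : n.-tuple R -> R) : (0 < n)%N ->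
  measurable_fun setT f -> (forall x, 0 <= f x) ->
  (\int[mu]_u radial_profile f u = \int[L n]_x (f x)%:E)%E.
Proof.
move=> n0 mf f0; have V0 := @ball_volume_gt0 R n.
have nR0 : 0 < n%:R :> R by rewrite ltr0n.
have mD := measurable_D mf.
pose w (u : R) := n%:R * ball_volume n * expR (- (n%:R * u)).
have w0 u : 0 <= w u by rewrite !mulr_ge0 ?expR_ge0 ?ltW.
have mw : measurable_fun setT w by exact: measurable_weight.
pose K (z : measurableTypeR R * measurableTypeR R) := ((w z.2)%:E * (\1_(D f) z)%:E)%E.
have K0 z : (0 <= K z)%E by rewrite mule_ge0// lee_fin.
have mK : measurable_fun setT K.
  apply: emeasurable_funM; apply/measurable_EFinP; last exact: measurable_indic.
  exact: (measurableT_comp mw measurable_snd).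
transitivity (\int[mu]_u \int[mu]_a K (a, u))%E.
  apply: eq_integral => u _.
  have mDu : measurable ([set a | D f (a, u)] : set (measurableTypeR R)).
    by rewrite -ysection_set; exact: measurable_ysection.
  transitivity ((w u)%:E * \int[mu]_a (\1_[set a | D f (a, u)] a)%:E)%E.
    by rewrite integral_indic// setIT.
  rewrite -ge0_integralZl ?lee_fin//; last exact/measurable_EFinP/measurable_indic.
rewrite -(@fubini_tonelli _ _ _ _ _ mu mu K)// layer_cake// [RHS]integral_mkcond.
apply: eq_integral => a _; rewrite patchE.
case: ifPn => a0; last first.
  rewrite integral0_eq// => u _; rewrite /K indicE memNset ?mule0//.
  by move=> [/= a0' _]; move: a0; rewrite notin_setE; apply; rewrite /= in_itv/= a0'.
rewrite -[RHS](@integral_exp_sublevel n%:R (ball_volume n))//.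
apply: eq_integral => u _; rewrite /K /=; congr (_ * _%:E)%E; rewrite !indicE.
congr (_%:R); congr (nat_of_bool _); apply/idP/idP; rewrite !inE.
  by case.
by split=> //=; move: a0; rewrite inE /= in_itv/= andbT.
Qed.

End radial.

(** * The inequality on Euclidean space *)

Section euclidean_inequality.
Context {R : realType}.
Local Notation mu := (@lebesgue_measure R).
Local Notation L := (@lebesgue_tuple R).

(** The Euclidean form of the constant function on the sphere, up to 2^n: the
density of stereographic projection. *)
Definition bubble n (x : n.-tuple R) : R := ((1 + enorm x ^+ 2) ^+ n)^-1.

Lemma bubble_base_gt0 n (x : n.-tuple R) : 0 < 1 + enorm x ^+ 2.
Proof. by rewrite ltr_wpDr// sqr_ge0. Qed.

Lemma measurable_bubble n : measurable_fun setT (@bubble n).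
Proof.
rewrite (_ : @bubble n = (@powR R ^~ (-1)) \o (fun x => (1 + enorm x ^+ 2) ^+ n)).
  apply: measurableT_comp; first exact: measurable_powR.
  apply: measurable_funX; apply: measurable_funD => //.
  by apply: measurable_funX; exact: measurable_enorm.
by apply/funext => x /=; rewrite powR_inv1// exprn_ge0// ltW// bubble_base_gt0.
Qed.

Lemma bubble_ge0 n (x : n.-tuple R) : 0 <= bubble x.
Proof. by rewrite invr_ge0 exprn_ge0// ltW// bubble_base_gt0. Qed.

(** The radial profile of the bubble in closed form. *)
Let h n (z : R) : R := n%:R * ball_volume n * ((expR z + expR (- z)) ^+ n)^-1.

Let h_ge0 n z : 0 <= h n z.
Proof.
by rewrite /h !mulr_ge0 ?invr_ge0 ?exprn_ge0 ?addr_ge0 ?expR_ge0// ltW// ball_volume_gt0.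
Qed.

Let measurable_h n : measurable_fun setT (h n).
Proof.
apply: measurable_funM => //.
rewrite (_ : (fun z => _) = (@powR R ^~ (-1)) \o (fun z => (expR z + expR (- z)) ^+ n)).
  apply: measurableT_comp; first exact: measurable_powR.
  apply: measurable_funX; apply: measurable_funD => //.
  by apply: (measurableT_comp (f := expR)).
by apply/funext => x /=; rewrite powR_inv1// exprn_ge0// addr_ge0 ?expR_ge0.
Qed.

(** The level set of the bubble at height a is a ball whose radius exceeds
al. *)
Lemma bubble_level n (al a : R) : (0 < n)%N -> 0 < al -> 0 < a ->
  a < ((1 + al ^+ 2) ^+ n)^-1 ->
  ((ball_volume n * al ^+ n)%:E < L n [set x | (a < bubble x)%R])%E.
Proof.
move=> n0 al0 a0 aq.
have s0 : 0 < 1 + al ^+ 2 by rewrite ltr_wpDr// sqr_ge0.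
have [s s1 sn] := @nth_root R a^-1 n n0 (eq_ind_r _ a0 (invr_gt0 a)).
have sal : 1 + al ^+ 2 < s.
  rewrite -(@ltr_pXn2r _ n)// ?nnegrE ?(ltW s0) ?(ltW s1)// sn.
  by rewrite -[ltLHS]invrK ltf_pV2// posrE// (lt_trans a0).
have al2 : al ^+ 2 < s - 1 by rewrite ltrBrDl.
have r0 : 0 < s - 1 by apply: le_lt_trans al2; exact: sqr_ge0.
have [r r0' r2] := @nth_root R (s - 1) 2 isT r0.
have alr : al < r by rewrite -(@ltr_pXn2r _ 2)// ?nnegrE ?ltW// r2.
apply: (@lt_le_trans _ _ (ball_volume n * r ^+ n)%:E).
  rewrite lte_fin ltr_pM2l ?ball_volume_gt0// ltr_pXn2r// ?nnegrE ?ltW//.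
rewrite -lebesgue_open_ball//; apply: le_measure; rewrite ?inE.
- exact: measurable_enorm_lt.
- exact: measurable_superlevel (@measurable_bubble n) a.
move=> x /= xr; rewrite /bubble -[ltLHS]invrK -sn ltf_pV2 ?posrE ?exprn_gt0 ?bubble_base_gt0//.
rewrite ltr_pXn2r// ?nnegrE ?(ltW s1) ?(ltW (bubble_base_gt0 _))//.
by rewrite -ltrBrDl -r2 ltr_pXn2r// ?nnegrE ?enorm_ge0// ltW.
Qed.

Let h_le_profile n z : (0 < n)%N -> ((h n z)%:E <= radial_profile (@bubble n) z)%E.
Proof.
move=> n0; have V0 := @ball_volume_gt0 R n.
pose al := expR (- z).
have alE : expR (- (n%:R * z)) = al ^+ n by rewrite /al -expRM_natl mulrN.
have q0 : 0 < (1 + al ^+ 2) ^+ n by rewrite exprn_gt0// ltr_wpDr// sqr_ge0.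
have hE : h n z = n%:R * ball_volume n * al ^+ n * ((1 + al ^+ 2) ^+ n)^-1.
  rewrite /h -[RHS]mulrA; congr (_ * _); rewrite -exprVn -[in RHS]exprVn -exprMn.
  congr (_ ^+ n).
  rewrite -/al -[expR z]invrK -expRN -/al; field.
  by rewrite !lt0r_neq0// ?expR_gt0// ltr_wpDr// sqr_ge0.
rewrite hE EFinM /radial_profile alE; apply: lee_pmul => //.
- by rewrite lee_fin !mulr_ge0 ?exprn_ge0 ?expR_ge0 ?(ltW V0).
- by rewrite lee_fin invr_ge0 ltW.
apply: (@le_trans _ _ (mu `]0, ((1 + al ^+ 2) ^+ n)^-1[)).
  by rewrite lebesgue_measure_itv/= lte_fin invr_gt0 q0 oppr0 adde0.
apply: le_measure; rewrite ?inE//.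
  by rewrite -alE; exact: measurable_radial_levels (@measurable_bubble n).
move=> a /=; rewrite in_itv/= => /andP[a0 aq]; split=> //.
by apply: bubble_level => //; exact: expR_gt0.
Qed.

Let integral_neg (k : R -> \bar R) : measurable_fun setT k -> (forall x, 0 <= k x)%E ->
  (\int[mu]_x k (- x)%R = \int[mu]_x k x)%E.
Proof.
move=> mk k0.
have mN : measurable_fun setT (fun x : R => - x) by exact: oppr_measurable.
rewrite [RHS](@integral_density _ _ _ _ _ mu mu (fun x => - x) (cst 1)) //.
  by apply: eq_integral => x _; rewrite /= mule1.
move=> E mE; have mNE : measurable ((fun x : R => - x) @^-1` E : set (measurableTypeR R)).
  by rewrite -[X in measurable X]setTI; exact: mN.
by rewrite -[LHS]lebesgue_measureN// (integral_cst mu mNE 1%:E) mul1e.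
Qed.

(** The profile of f at u and the profile of g at - w are compared with h at the
midpoint of u and w. For al = exp(-u) and be = exp(w), the bound
a b (al + be)^(2n) <= 1 on heights, multiplied by the weights al^n and be^n, is
exactly h((u + w) / 2)^2, because
(al + be)^2 = al be (exp(z) + exp(-z))^2 for z = (u + w) / 2. *)
Theorem euclidean_inequality n (f g : n.-tuple R -> R) (I J : R) : (0 < n)%N ->
  measurable_fun setT f -> measurable_fun setT g ->
  (forall x, 0 <= f x) -> (forall x, 0 <= g x) ->
  (forall A B, measurable A -> measurable B -> (0 < L n A)%E -> (0 < L n B)%E ->
    exists x y, [/\ A x, B y & f x * g y * Defs.edist x y ^+ (2 * n) <= 1]) ->
  0 <= I -> 0 <= J ->
  (I%:E < \int[L n]_x (f x)%:E)%E -> (J%:E < \int[L n]_x (g x)%:E)%E ->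
  ((I `^ 2^-1 * J `^ 2^-1)%:E <= \int[L n]_x (bubble x)%:E)%E.
Proof.
move=> n0 mf mg f0 g0 H I0 J0 If Jg.
have V0 := @ball_volume_gt0 R n.
have n0R : 0 < n%:R :> R by rewrite ltr0n.
have prof0 (k : n.-tuple R -> R) u : (0 <= radial_profile k u)%E.
  rewrite mule_ge0// lee_fin; apply: mulr_ge0; last exact: expR_ge0.
  by apply: mulr_ge0 => //; exact: ltW.
rewrite -(integral_radial_profile n0 mf f0) in If.
rewrite -(integral_radial_profile n0 mg g0) in Jg.
rewrite -(integral_radial_profile n0 (@measurable_bubble n) (@bubble_ge0 n)).
have mpf := measurable_radial_profile mf.
have mpg := measurable_radial_profile mg.
rewrite -(integral_neg mpg (prof0 g)) in Jg.
apply: (@le_trans _ _ (\int[mu]_z (h n z)%:E)%E); last first.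
  apply: ge0_le_integral => //.
  - by move=> x _; rewrite lee_fin.
  - by apply/measurable_EFinP; exact: measurable_h.
  - exact: measurable_radial_profile (@measurable_bubble n).
  - by move=> z _; exact: h_le_profile.
have half : 0 < (2^-1 : R) < 1 by lra.
rewrite [X in _ * _ `^ X](_ : 2^-1 = 1 - 2^-1); last by field.
apply: (prekopa_leindler half _ _ _ _ _ _ _ I0 J0 If Jg) => //.
- by apply: (measurableT_comp mpg); exact: oppr_measurable.
- by apply/measurable_EFinP; exact: measurable_h.
- by move=> z; rewrite lee_fin.
move=> u w c d c0 d0 cf dg.
have level (k : n.-tuple R -> R) (v e : R) :
    measurable_fun setT k -> 0 <= e -> (e%:E < radial_profile k v)%E ->
    exists2 a, 0 < a & e <= n%:R * ball_volume n * expR (- v) ^+ n * a /\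
      ((ball_volume n * expR (- v) ^+ n)%:E < L n [set x | (a < k x)%R])%E.
  move=> mk e0; rewrite /radial_profile (_ : expR (- (n%:R * v)) = expR (- v) ^+ n); last first.
    by rewrite -expRM_natl mulrN.
  set W := n%:R * _ * _; set S := [set a | _] => eS.
  have W0 : 0 < W by rewrite /W !mulr_gt0// exprn_gt0// expR_gt0.
  apply: contrapT => nS; move: eS; apply/negP; rewrite -leNgt.
  rewrite -lee_pdivlMl//.
  apply: (@le_trans _ _ (mu `]0, W^-1 * e])).
    apply: le_measure; rewrite ?inE//.
      have := measurable_radial_levels v mk.
      by rewrite (_ : expR (- (n%:R * v)) = expR (- v) ^+ n)// -expRM_natl mulrN.
    move=> a [a0 aS]; rewrite /= in_itv/= a0/= leNgt; apply/negP => ea.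
    apply: nS; exists a => //; split=> //.
    by rewrite -ler_pdivrMl// ltW.
  rewrite lebesgue_measure_itv/= lte_fin oppr0 adde0 -EFinM; case: ifP => // _.
  by rewrite lee_fin mulr_ge0// invr_ge0 ltW.
have [a a0 [ca fa]] := level f u c mf c0 cf.
have [b b0 [db gb]] := level g (- w) d mg d0 dg.
have := level_sets_bound n0 mf mg H a0 b0 (expR_gt0 _) (expR_gt0 _) fa gb.
set al := expR (- u) in ca fa *; rewrite opprK in db gb *; set be := expR w in db gb * => key.
have al0 : 0 < al by exact: expR_gt0.
have be0 : 0 < be by exact: expR_gt0.
rewrite lee_fin (_ : 1 - 2^-1 = 2^-1 :> R); last by field.
rewrite -powRM// -[leRHS]ger0_norm// -sqrtr_sqr powR12_sqrt ?mulr_ge0//.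
rewrite ler_wsqrtr//.
apply: le_trans (ler_pM c0 d0 ca db) _.
rewrite /h exprMn exprVn -exprM.
pose z := 2^-1 * u + 2^-1 * w.
have E : (expR z + expR (- z)) ^+ 2 * (al * be) = (al + be) ^+ 2.
  pose P := expR (2^-1 * u); pose Q := expR (2^-1 * w).
  have P0 : P != 0 by rewrite lt0r_neq0// expR_gt0.
  have Q0 : Q != 0 by rewrite lt0r_neq0// expR_gt0.
  have alE : expR (- u) = (P ^+ 2)^-1.
    by rewrite /P -expRM_natl -expRN; congr expR; field.
  have beE : expR w = Q ^+ 2 by rewrite /Q -expRM_natl; congr expR; field.
  rewrite /al /be alE beE.
  by rewrite expRN /z expRD -/P -/Q; field; rewrite P0 Q0.
have E' : al ^+ n * be ^+ n * (al + be) ^- (2 * n) = ((expR z + expR (- z)) ^+ (n * 2))^-1.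
  have X0 : (al * be) ^+ n != 0 by rewrite lt0r_neq0// exprn_gt0// mulr_gt0.
  rewrite -exprMn [(n * 2)%N]mulnC !exprM -E.
  move: X0; move: (al * be) ((expR z + expR (- z)) ^+ 2) => X T X0.
  by rewrite exprMn invfM mulrCA mulfV// mulr1.
rewrite -E' [leLHS](_ : _ =
  (n%:R * ball_volume n) ^+ 2 * ((al ^+ n * be ^+ n) * (a * b))); last by ring.
apply: ler_wpM2l; first exact: sqr_ge0.
rewrite ler_pM2l ?mulr_gt0 ?exprn_gt0// -[leRHS]mul1r ler_pdivlMr// exprn_gt0// addr_gt0//.
Qed.

End euclidean_inequality.

(** * A rational substitution *)

Section stereographic_substitution.
Context {R : realType}.
Local Notation mu := (@lebesgue_measure R).

(** For fixed last coordinates y, with c = |y|^2, the height t of the point (t, y)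
is (c / l - l) / 2 in terms of l = |(t, y)| - t. The power - 1 replaces the
inverse because it is a measurable function on the whole line; the two agree for
positive l. *)
Definition stereo_height (c x : R) : R := (c * x `^ (-1) - x) / 2.

Definition stereo_weight (c x : R) : R :=
  \1_(`]0, +oo[%classic : set R) x * ((c * (x `^ (-1)) ^+ 2 + 1) / 2).

Lemma stereo_weight_ge0 c x : 0 <= c -> 0 <= stereo_weight c x.
Proof.
move=> c0; rewrite /stereo_weight mulr_ge0// divr_ge0// addr_ge0// mulr_ge0//.
exact: sqr_ge0.
Qed.

Lemma integral_exprn_itv n (s : R) : 0 < s ->
  (\int[mu]_(x in `]0%R, s[) (x ^+ n)%:E = (s ^+ n.+1 / n.+1%:R)%:E)%E.
Proof.
move=> s0; rewrite integral_itv_obnd_cbnd; last first.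
  by apply/measurable_EFinP/measurable_funTS; exact: measurable_funX.
rewrite integral_itv_bndo_bndc; last first.
  by apply/measurable_EFinP/measurable_funTS; exact: measurable_funX.
pose F (x : R) := n.+1%:R^-1 * x ^+ n.+1.
have dF (x : R) : is_derive (x : R) (1 : R) F (x ^+ n).
  have -> : F = n.+1%:R^-1 \*: ((@id R) ^+ n.+1).
    by apply/funext => y; rewrite /F /= exprfctE.
  apply: is_derive_eq; rewrite /GRing.scale/= mulr1 mulrA mulVf ?mul1r//.
have cF : continuous F.
  by move=> x; apply/differentiable_continuous/derivable1_diffP; case: (dF x).
rewrite (@continuous_FTC2 R (fun x => x ^+ n) F)//.
- by rewrite /F expr0n mulr0 sube0 mulrC.
- by apply: continuous_subspaceT => x; exact: exprn_continuous.
- split.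
  + by move=> x _; case: (dF x).
  + exact/cvg_at_right_filter/cF.
  + exact/cvg_at_left_filter/cF.
- by move=> x _; rewrite derive1E; case: (dF x).
Qed.

(** The map [stereo_height c] decreases from infinity to minus infinity on the
positive half-line, with inverse t |-> sqrt (c + t^2) - t, and minus its
derivative is [stereo_weight c]. *)
Lemma stereo_height_substitution (c : R) (E : set (measurableTypeR R)) : 0 < c ->
  measurable E ->
  (mu E = \int[mu]_(x in stereo_height c @^-1` E) (stereo_weight c x)%:E)%E.
Proof.
move=> c0 mE.
have mi : measurable_fun setT (fun x : R => x `^ (-1)) by exact: measurable_powR.
have mh : measurable_fun setT (stereo_height c).
  by apply: measurable_funM => //; apply: measurable_funB => //; exact: measurable_funM.
have mw : measurable_fun setT (stereo_weight c).
  apply: measurable_funM; first exact: measurable_indic.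
  apply: measurable_funM => //; apply: measurable_funD => //.
  by apply: measurable_funM => //; exact: measurable_funX.
apply: lebesgue_measure_density => //.
  by move=> x; exact/stereo_weight_ge0/ltW.
move=> a b ab.
pose s t := Num.sqrt (c + t ^+ 2) - t.
have s_gt0 t : 0 < s t.
  rewrite subr_gt0 (le_lt_trans (ler_norm _))// -sqrtr_sqr ltr_sqrt ?ltrDr//.
  by rewrite ltr_wpDr// sqr_ge0.
have sE t : c = s t ^+ 2 + 2 * t * s t.
  have : Num.sqrt (c + t ^+ 2) ^+ 2 = c + t ^+ 2.
    by rewrite sqr_sqrtr// addr_ge0 ?sqr_ge0// ltW.
  by rewrite /s; move: (Num.sqrt _) => q; nra.
have hE x : 0 < x -> stereo_height c x = (c / x - x) / 2.
  by move=> x0; rewrite /stereo_height powR_inv1// ltW.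
have h_lt t x : 0 < x -> (t < stereo_height c x) = (x < s t).
  move=> x0; have s2 : 0 < s t + 2 * t.
    by rewrite -(pmulr_rgt0 _ (s_gt0 t)) mulrDr -expr2 [s t * _]mulrC -sE.
  rewrite hE// ltr_pdivlMr// ltrBrDr ltr_pdivlMr// {1}(sE t).
  rewrite -subr_gt0 (_ : _ - _ = (s t - x) * (x + (s t + 2 * t))); last by ring.
  by rewrite pmulr_lgt0 ?subr_gt0// addr_gt0.
have hs t : stereo_height c (s t) = t.
  by rewrite hE// {1}(sE t); field; rewrite lt0r_neq0.
have h_le t x : 0 < x -> (stereo_height c x <= t) = (s t <= x).
  by move=> x0; rewrite leNgt h_lt// -leNgt.
have sba : s b < s a.
  by rewrite -h_lt// hs.
transitivity (\int[mu]_(x in `[s b, s a[) ((c / x ^+ 2 + 1) / 2)%:E)%E.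
  rewrite [LHS]integral_mkcond [RHS]integral_mkcond; apply: eq_integral => x _.
  rewrite !patchE.
  have [x0|x0] := ltP 0 x; last first.
    rewrite [in RHS]ifF; last first.
      by apply/negP; rewrite inE /= in_itv/= => /andP[sx _];
        move: (lt_le_trans (s_gt0 b) sx); rewrite ltNge x0.
    case: ifP => // _; rewrite /stereo_weight indicE memNset ?mul0r//=.
    by rewrite in_itv/= andbT ltNge x0.
  have -> : (x \in stereo_height c @^-1` `]a, b]) = (x \in (`[s b, s a[%classic : set R)).
    apply/idP/idP; rewrite !inE /= !in_itv/= => /andP[h1 h2].
      by rewrite -h_le// -h_lt// h1 h2.
    by rewrite h_le// h_lt// h1 h2.
  case: ifP => // _; rewrite /stereo_weight indicE mem_set ?mul1r/=; last first.
    by rewrite in_itv/= x0.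
  by rewrite powR_inv1 ?exprVn// ltW.
pose F (x : R) := (x - c * x^-1) / 2.
have dF (x : R) : 0 < x -> is_derive (x : R) (1 : R) F ((c / x ^+ 2 + 1) / 2).
  move=> x0; have xn0 : x != 0 by rewrite gt_eqF.
  have -> : F = 2^-1 \*: ((@id R) - c \*: (fun y : R => y^-1)).
    by apply/funext => y; rewrite /F mulrC.
  have := @is_deriveV R (@id R) x 1 1 xn0 (is_derive_id _ _) => dV.
  apply: is_derive_eq; rewrite /GRing.scale/=; field.
  done.
have cf (x : R) : 0 < x -> {for x, continuous (fun y : R => (c / y ^+ 2 + 1) / 2 : R)}.
  move=> x0; apply: cvgM; last exact: cvg_cst.
  apply: cvgD; last exact: cvg_cst.
  apply: cvgM; first exact: cvg_cst.
  apply: cvgV; last exact: exprn_continuous.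
  by rewrite expf_neq0// gt_eqF.
have cF (x : R) : 0 < x -> {for x, continuous F}.
  by move=> x0; apply/differentiable_continuous/derivable1_diffP; case: (dF x x0).
have pos x : s b <= x -> 0 < x by exact: lt_le_trans.
rewrite integral_itv_bndo_bndc; last first.
  apply/measurable_EFinP; apply: (eq_measurable_fun (stereo_weight c)) => [x|]; last exact: measurable_funTS.
  rewrite inE /= in_itv/= => /andP[/pos x0 _].
  rewrite /stereo_weight indicE mem_set ?mul1r/= ?in_itv/= ?x0//.
  by rewrite powR_inv1 ?exprVn// ltW.
rewrite (@continuous_FTC2 R (fun x => (c / x ^+ 2 + 1) / 2) F)//.
- rewrite /F -EFinB; congr EFin; rewrite {1}(sE a) (sE b).
  by field; rewrite !lt0r_neq0.
- apply: continuous_in_subspaceT => x; rewrite inE /= in_itv/= => /andP[/pos x0 _].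
  exact: cf.
- split.
  + by move=> x; rewrite in_itv/= => /andP[/ltW/pos/dF[]].
  + exact/cvg_at_right_filter/cF.
  + exact/cvg_at_left_filter/cF.
- by move=> x; rewrite in_itv/= => /andP[/ltW/pos/dF[]]; rewrite derive1E.
Qed.

End stereographic_substitution.

(** * Stereographic projection *)

Section stereographic.
Context {R : realType}.
Local Notation mu := (@lebesgue_measure R).
Local Notation L := (@lebesgue_tuple R).

Lemma enorm_cons_sqr n (t : R) (x : n.-tuple R) :
  enorm (cons_pair (t, x)) ^+ 2 = t ^+ 2 + enorm x ^+ 2.
Proof.
rewrite !sqr_sqrtr; [|by apply: sumr_ge0 => i _; exact: sqr_ge0..].
rewrite big_ord_recl; congr (_ + _).
by apply: eq_bigr => i _; rewrite tnthS.
Qed.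

Definition stereo_tuple n (x : n.-tuple R) : n.+1.-tuple R :=
  cons_pair ((enorm x ^+ 2 - 1) / (1 + enorm x ^+ 2),
             scale_tuple (2 / (1 + enorm x ^+ 2)) x).

Lemma enorm_stereo n (x : n.-tuple R) : enorm (stereo_tuple x) == 1.
Proof.
have s0 := bubble_base_gt0 x.
rewrite -(@eqrXn2 _ 2)// ?enorm_ge0// enorm_cons_sqr enorm_scale; last first.
  by rewrite divr_ge0// ltW.
by apply/eqP; field; exact: lt0r_neq0.
Qed.

Definition stereo n (x : n.-tuple R) : sphere R n := Sphere (enorm_stereo x).

Lemma measurable_conformal_factor n (a : R) :
  measurable_fun setT (fun x : n.-tuple R => a / (1 + enorm x ^+ 2)).
Proof.
rewrite (_ : (fun x => _) = (fun x : n.-tuple R => a * (1 + enorm x ^+ 2) `^ (-1))).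
  apply: measurable_funM => //.
  apply: (measurableT_comp (f := @powR R ^~ (-1))); first exact: measurable_powR.
  by apply: measurable_funD => //; apply: measurable_funX; exact: measurable_enorm.
by apply/funext => x; rewrite powR_inv1// ltW// bubble_base_gt0.
Qed.

Lemma measurable_stereo_tuple n : measurable_fun setT (@stereo_tuple n).
Proof.
apply: (measurableT_comp (@measurable_cons_pair R n)).
apply: measurable_fun_pair.
  rewrite (_ : (fun x => _) = (fun x : n.-tuple R => 1 - 2 / (1 + enorm x ^+ 2))).
    by apply: measurable_funB => //; exact: measurable_conformal_factor.
  by apply/funext => x; field; exact/lt0r_neq0/bubble_base_gt0.
apply/measurable_fun_tnthP => i.
rewrite (_ : _ \o _ = (fun x : n.-tuple R => 2 / (1 + enorm x ^+ 2) * tnth x i)).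
  by apply: measurable_funM; [exact: measurable_conformal_factor|exact: measurable_tnth].
by apply/funext => x /=; rewrite tnth_mktuple.
Qed.

Lemma measurable_stereo n : measurable_fun setT (@stereo n).
Proof.
move=> _ E [B mB]; rewrite !setTI => <-.
by have := @measurable_stereo_tuple n measurableT B mB; rewrite setTI.
Qed.

Lemma lebesgue_tuple_scale_integral n (r : R) (g : n.-tuple R -> \bar R) : 0 < r ->
  measurable_fun setT g -> (forall x, 0 <= g x)%E ->
  (\int[L n]_y g y = \int[L n]_x (g (scale_tuple r x) * (r ^+ n)%:E))%E.
Proof.
move=> r0 mg g0.
apply: (@integral_density _ _ _ _ _ (L n) (L n) (scale_tuple r) (cst (r ^+ n))) => //.
- exact: measurable_scale_tuple.
- by move=> x; rewrite exprn_ge0// ltW.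
move=> E mE; rewrite (integral_cst (L n) (measurable_scale_preimage r mE) (r ^+ n)%:E).
by rewrite muleC -[in X in (_ * X)%E](gtr0_norm r0) lebesgue_tuple_scale// gt_eqF.
Qed.

(** The points of R^(n+1) outside a half-line are the points
(l (|x|^2 - 1) / 2, l x), with l > 0; in polar coordinates this point has radius
l (1 + |x|^2) / 2 and direction [stereo x]. *)
Lemma scale_stereo n (x : n.-tuple R) (l : R) :
  cons_pair (l * (enorm x ^+ 2 - 1) / 2, scale_tuple l x) =
  scale_tuple (l * (1 + enorm x ^+ 2) / 2) (stereo_tuple x).
Proof.
have s0 := lt0r_neq0 (bubble_base_gt0 x).
rewrite /stereo_tuple scale_tuple_cons scale_tupleA; congr cons_pair; congr pair.
  by field.
by congr scale_tuple; field.
Qed.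

Lemma cone_stereo n (E : set (sphere R n)) (x : n.-tuple R) (l : R) : 0 < l ->
  cone E (cons_pair (l * (enorm x ^+ 2 - 1) / 2, scale_tuple l x)) <->
  E (stereo x) /\ l < 2 / (1 + enorm x ^+ 2).
Proof.
move=> l0; have s0 := bubble_base_gt0 x.
have lt1 : (l < 2 / (1 + enorm x ^+ 2)) = (l * (1 + enorm x ^+ 2) / 2 < 1).
  by rewrite ltr_pdivlMr// ltr_pdivrMr// mul1r.
have r0 : 0 < l * (1 + enorm x ^+ 2) / 2 by rewrite divr_gt0// mulr_gt0.
rewrite scale_stereo lt1; split.
  move=> [r [s [/andP[r0' r1] Es e]]].
  by have [<- <-] := @scale_sphere_inj R n r _ s (stereo x) r0' r0 (esym e).
move=> [Ex l1]; exists (l * (1 + enorm x ^+ 2) / 2), (stereo x).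
by rewrite r0 l1.
Qed.

(** The volume of the cone over E, computed in the coordinates (l, x): the height
is replaced by l for fixed y (a function of one variable), then y by l x for
fixed l (a scaling), and the cone becomes the region where stereo x lies in E and
0 < l < s, with s = 2 / (1 + |x|^2). The Jacobian is l^n / s, and its integral
in l is s^n / (n + 1). *)
Lemma surface_measure_stereo n (E : set (sphere R n)) : (0 < n)%N -> measurable E ->
  (surface_measure E =
   \int[L n]_(x in @stereo n @^-1` E) ((2 / (1 + enorm x ^+ 2)) ^+ n)%:E)%E.
Proof.
move=> n0 mE; rewrite /surface_measure; set K := cone E.
have mK : measurable K by exact: measurable_cone.
have mi : measurable_fun setT (fun x : R => x `^ (-1)) by exact: measurable_powR.
pose G (z : n.-tuple R * measurableTypeR R) : \bar R :=
  ((stereo_weight (enorm z.1 ^+ 2) z.2)%:E *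
   (\1_K (cons_pair (stereo_height (enorm z.1 ^+ 2) z.2, z.1)))%:E)%E.
have sq_ge0 (x : n.-tuple R) : 0 <= enorm x ^+ 2 by exact: sqr_ge0.
have G0 z : (0 <= G z)%E by rewrite mule_ge0// lee_fin// stereo_weight_ge0.
have m1 : measurable_fun setT (fun z : n.-tuple R * measurableTypeR R => enorm z.1 ^+ 2).
  by apply: measurable_funX; exact: (measurableT_comp (@measurable_enorm R n)).
have m2 : measurable_fun setT (fun z : n.-tuple R * measurableTypeR R => z.2 `^ (-1)).
  exact: (measurableT_comp mi measurable_snd).
have mpos : measurable_fun setT (fun z : n.-tuple R * measurableTypeR R =>
    \1_(`]0, +oo[%classic : set R) z.2 : R).
  have mI : measurable (`]0, +oo[%classic : set (measurableTypeR R)) by exact: measurable_itv.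
  exact: (@measurableT_comp _ _ _ _ _ _ (\1_(`]0, +oo[%classic : set R) : measurableTypeR R -> R)
    _ _ (measurable_indic mI) measurable_snd).
have mh : measurable_fun setT (fun z : n.-tuple R * measurableTypeR R =>
    stereo_height (enorm z.1 ^+ 2) z.2).
  apply: measurable_funM => //; apply: measurable_funB => //; exact: measurable_funM.
have mw : measurable_fun setT (fun z : n.-tuple R * measurableTypeR R =>
    stereo_weight (enorm z.1 ^+ 2) z.2).
  apply: measurable_funM => //; apply: measurable_funM => //; apply: measurable_funD => //.
  by apply: measurable_funM => //; exact: measurable_funX.
have m1K (p : n.-tuple R * measurableTypeR R -> n.+1.-tuple R) : measurable_fun setT p ->
    measurable_fun setT (fun z => \1_K (p z) : R).
  move=> mp.
  exact: (@measurableT_comp _ _ _ _ _ _ (\1_K : n.+1.-tuple R -> R) _ _ (measurable_indic mK) mp).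
have mG : measurable_fun setT G.
  apply: emeasurable_funM; apply/measurable_EFinP => //.
  apply: m1K; apply: (measurableT_comp (@measurable_cons_pair R n)).
  by apply: measurable_fun_pair.
rewrite lebesgue_tuple_ysection//.
transitivity (n.+1%:R%:E * \int[L n]_y \int[mu]_l G (y, l))%E.
  congr (_ * _)%E; apply: ge0_ae_eq_integral => //.
  - exact: (measurable_fun_yset mu (measurable_cons_preimage mK)).
  - exact: (measurable_fun_fubini_tonelli_F G mG G0).
  - by move=> y _; apply: integral_ge0.
  (* on the axis y = 0 the substitution degenerates *)
  exists [set x | enorm x = 0]; split.
  - rewrite (_ : [set x | _] = [set x | enorm x <= 0]); first exact: measurable_enorm_le.
    apply/seteqP; split=> x /=; first by move->.
    by move=> x0; apply/le_anti; rewrite x0 enorm_ge0.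
  - exact: lebesgue_tuple_set0.
  move=> y /= H; apply: contrapT => y0; apply: H => _.
  have c0 : 0 < enorm y ^+ 2.
    by rewrite exprn_gt0// lt_neqAle enorm_ge0 andbT eq_sym; apply/eqP.
  rewrite (stereo_height_substitution c0 (measurable_tuple_ysection y mK)).
  rewrite integral_mkcond; apply: eq_integral => l _; rewrite patchE /G indicE /=.
  have -> : (l \in stereo_height (enorm y ^+ 2) @^-1` [set t | K (cons_pair (t, y))]) =
      (cons_pair (stereo_height (enorm y ^+ 2) l, y) \in K).
    by apply/idP/idP; rewrite !inE.
  by case: (_ \in K); rewrite ?mule1 ?mule0.
rewrite (@fubini_tonelli _ _ _ _ _ (L n) mu G mG G0).
pose H (z : n.-tuple R * measurableTypeR R) : \bar R :=
  (\1_(`]0, +oo[%classic : set R) z.2 * (z.2 ^+ n * ((1 + enorm z.1 ^+ 2) / 2)) *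
   (\1_K (cons_pair (z.2 * (enorm z.1 ^+ 2 - 1) / 2, scale_tuple z.2 z.1))))%:E.
have pos1 (l : R) : 0 < l -> \1_(`]0, +oo[%classic : set R) l = 1 :> R.
  by move=> l0; rewrite indicE mem_set//= in_itv/= l0.
have neg1 (l : R) : l <= 0 -> \1_(`]0, +oo[%classic : set R) l = 0 :> R.
  by move=> l0; rewrite indicE memNset//= in_itv/= andbT ltNge l0.
have H0 z : (0 <= H z)%E.
  rewrite lee_fin; apply: mulr_ge0 => //.
  have [l0|l0] := ltP 0 z.2; last by rewrite neg1// mul0r.
  by rewrite mulr_ge0// mulr_ge0 ?exprn_ge0 ?(ltW l0)// divr_ge0// addr_ge0.
have mH : measurable_fun setT H.
  apply/measurable_EFinP; apply: measurable_funM.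
    apply: measurable_funM => //; apply: measurable_funM; first exact: measurable_funX.
    by apply: measurable_funM => //; exact: measurable_funD.
  apply: m1K; apply: (measurableT_comp (@measurable_cons_pair R n)).
  apply: measurable_fun_pair.
    apply: measurable_funM => //; apply: measurable_funM => //.
    exact: measurable_funB.
  apply/measurable_fun_tnthP => i.
  rewrite (_ : _ \o _ = (fun z : n.-tuple R * measurableTypeR R => z.2 * tnth z.1 i)).
    apply: measurable_funM => //.
    exact: (measurableT_comp (measurable_tnth i) measurable_fst).
  by apply/funext => z /=; rewrite tnth_mktuple.
transitivity (n.+1%:R%:E * \int[mu]_l \int[L n]_x H (x, l))%E.
  apply: congr1; apply: eq_integral => l _.
  have [l0|l0] := ltP 0 l; last first.
    rewrite !integral0_eq// => x _; first by rewrite /H /= neg1// !mul0r.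
    by rewrite /G /= /stereo_weight neg1// mul0r mul0e.
  rewrite (@lebesgue_tuple_scale_integral n l (fun y => G (y, l)) l0)//; last first.
    exact: (measurable_fun_pair1 l mG).
  apply: eq_integral => x _; rewrite /G /H /= /stereo_weight /stereo_height pos1// !mul1r.
  rewrite enorm_scale ?(ltW l0)// powR_inv1 ?(ltW l0)//.
  have ln0 := lt0r_neq0 l0.
  have -> : ((l * enorm x) ^+ 2 * l^-1 - l) / 2 = l * (enorm x ^+ 2 - 1) / 2 by field.
  have -> : ((l * enorm x) ^+ 2 * l^-1 ^+ 2 + 1) / 2 = (1 + enorm x ^+ 2) / 2 by field.
  by rewrite -!EFinM; congr EFin; ring.
rewrite -(@fubini_tonelli _ _ _ _ _ (L n) mu H mH H0).
have mF : measurable_fun setT (fun x => \int[mu]_l H (x, l))%E.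
  exact: (measurable_fun_fubini_tonelli_F H mH H0).
have F0 (x : n.-tuple R) : [set: n.-tuple R] x -> (0 <= \int[mu]_l H (x, l))%E.
  by move=> _; apply: integral_ge0.
rewrite -(@ge0_integralZl _ _ _ (L n) setT measurableT _ mF n.+1%:R%:E F0) ?lee_fin//.
rewrite [RHS]integral_mkcond; apply: eq_integral => x _.
rewrite patchE.
have b0 := bubble_base_gt0 x; pose s := 2 / (1 + enorm x ^+ 2).
have s0 : 0 < s by rewrite divr_gt0.
case: ifPn => [/set_mem /= Ex|/negP nEx]; last first.
  rewrite integral0_eq ?mule0// => l _; rewrite /H /=.
  have [l0|l0] := ltP 0 l; last by rewrite neg1// !mul0r.
  rewrite [X in _ * X](_ : _ = 0) ?mulr0// indicE memNset// => /(cone_stereo _ _ l0)[Ex _].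
  by apply: nEx; rewrite inE.
transitivity (n.+1%:R%:E * \int[mu]_(l in `]0%R, s[) (s^-1%:E * (l ^+ n)%:E))%E.
  congr (_ * _)%E; rewrite [RHS]integral_mkcond; apply: eq_integral => l _.
  rewrite patchE /H /=.
  have [l0|l0] := ltP 0 l; last first.
    rewrite neg1// !mul0r memNset//= in_itv/= => /andP[l0' _].
    by move: l0; rewrite leNgt l0'.
  rewrite pos1// mul1r; case: ifPn => ls.
    rewrite indicE mem_set; last first.
      apply/(cone_stereo _ _ l0); split => //.
      by move: ls; rewrite inE /= in_itv/= => /andP[].
    by rewrite mulr1 -EFinM mulrC /s invf_div.
  rewrite indicE memNset ?mulr0// => /(cone_stereo _ _ l0)[_ ls'].
  by move/negP : ls; apply; rewrite inE /= in_itv/= l0.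
rewrite ge0_integralZl//; last 3 first.
- by apply/measurable_EFinP/measurable_funTS; exact: measurable_funX.
- by move=> l; rewrite /= in_itv/= => /andP[l0 _]; rewrite lee_fin exprn_ge0// ltW.
- by rewrite lee_fin invr_ge0 ltW.
rewrite integral_exprn_itv// -!EFinM -/s; congr EFin; rewrite exprS; field.
by rewrite addrC natr1 pnatr_eq0 lt0r_neq0.
Qed.

End stereographic.

(** * The inequality on the sphere for p = 1 *)

Section sphere_inequality.
Context {R : realType}.
Local Notation mu := (@lebesgue_measure R).
Local Notation L := (@lebesgue_tuple R).

Lemma integral_pos_gt0 d (T : measurableType d) (m : {measure set T -> \bar R})
    (A : set T) (f : T -> R) : measurable A -> measurable_fun setT f ->
  (forall x, 0 < f x) -> (0 < m A)%E -> (0 < \int[m]_(x in A) (f x)%:E)%E.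
Proof.
move=> mA mf f0 A0.
have i0 : (0 <= \int[m]_(x in A) (f x)%:E)%E.
  by apply: integral_ge0 => x _; rewrite lee_fin ltW.
rewrite lt_neqAle i0 andbT eq_sym; apply/eqP => I0; move: A0; apply/negP; rewrite -leNgt.
have mfA : measurable_fun A (EFin \o f).
  by apply/measurable_EFinP; exact: measurable_funTS.
have [] := (@ae_eq_integral_abs _ _ _ m A mA _ mfA).1.
  rewrite -[RHS]I0; apply: eq_integral => x _; rewrite gee0_abs// lee_fin ltW//.
move=> N [mN N0 sub]; rewrite -N0; apply: le_measure; rewrite ?inE//.
move=> x Ax; apply: sub => /= /(_ Ax) /= [fx0].
by have := f0 x; rewrite fx0 ltxx.
Qed.

Definition stereo_density n (x : n.-tuple R) : R := (2 / (1 + enorm x ^+ 2)) ^+ n.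

Lemma stereo_density_gt0 n (x : n.-tuple R) : 0 < stereo_density x.
Proof. by rewrite exprn_gt0// divr_gt0// bubble_base_gt0. Qed.

Lemma measurable_stereo_density n : measurable_fun setT (@stereo_density n).
Proof. by apply: measurable_funX; exact: measurable_conformal_factor. Qed.

Lemma integral_sphere n (k : sphere R n -> \bar R) : (0 < n)%N ->
  measurable_fun setT k -> (forall s, 0 <= k s)%E ->
  (\int[surface_measure]_s k s =
   \int[L n]_x (k (stereo x) * (stereo_density x)%:E))%E.
Proof.
move=> n0 mk k0; apply: integral_density => //.
- exact: measurable_stereo.
- exact: measurable_stereo_density.
- by move=> x; exact/ltW/stereo_density_gt0.
- by move=> E mE; exact: surface_measure_stereo.
Qed.

Lemma edist_stereo n (x y : n.-tuple R) :
  Defs.edist (stereo x) (stereo y) ^+ 2 =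
  Defs.edist x y ^+ 2 * (2 / (1 + enorm x ^+ 2)) * (2 / (1 + enorm y ^+ 2)).
Proof.
have ed m (a b : R) (u v : m.-tuple R) :
    \sum_(i < m) (a * tnth u i - b * tnth v i) ^+ 2 =
    a ^+ 2 * enorm u ^+ 2 + b ^+ 2 * enorm v ^+ 2
    - 2 * a * b * (\sum_(i < m) tnth u i * tnth v i).
  rewrite !sqr_sqrtr; [|by apply: sumr_ge0 => i _; exact: sqr_ge0..].
  rewrite !mulr_sumr -big_split/= -sumrB; apply: eq_bigr => i _; ring.
have e1 : Defs.edist x y ^+ 2 =
    enorm x ^+ 2 + enorm y ^+ 2 - 2 * (\sum_(i < n) tnth x i * tnth y i).
  rewrite sqr_sqrtr; last by apply: sumr_ge0 => i _; exact: sqr_ge0.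
  have := ed n 1 1 x y; rewrite expr1n !mul1r !mulr1 => <-.
  by apply: eq_bigr => i _; rewrite !mul1r.
rewrite e1 sqr_sqrtr; last by apply: sumr_ge0 => i _; exact: sqr_ge0.
rewrite big_ord_recl/=.
under eq_bigr => i _ do rewrite !tnthS !tnth_mktuple.
rewrite ed.
have x0 := lt0r_neq0 (bubble_base_gt0 x); have y0 := lt0r_neq0 (bubble_base_gt0 y).
move: x0 y0; rewrite /tnth/=.
move: (enorm x ^+ 2) (enorm y ^+ 2) (\sum_(i < n) _) => X Y P X0 Y0.
by field; rewrite X0 Y0.
Qed.

(** A product of sets of positive measure is not contained in the negligible set
of exceptions. The densities being positive, positivity may be read in
stereographic coordinates. *)
Lemma rectangle_ae n (A B : set (n.-tuple R)) (P : sphere R n * sphere R n -> Prop) : (0 < n)%N ->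
  measurable A -> measurable B -> (0 < L n A)%E -> (0 < L n B)%E ->
  {ae (surface_measure \x surface_measure)%E, forall z, P z} ->
  exists x y, [/\ A x, B y & P (stereo x, stereo y)].
Proof.
move=> n0 mA mB A0 B0 [N [mN N0 sub]].
apply: contrapT => nex; move: N0; apply/eqP; rewrite gt_eqF//.
rewrite /product_measure1 integral_sphere//; last exact: measurable_fun_xsection.
have ms := @measurable_stereo R n.
set cB := (\int[L n]_(y in B) (stereo_density y)%:E)%E.
have mw := @measurable_stereo_density n.
have cB0 : (0 < cB)%E by apply: integral_pos_gt0 => // x; exact: stereo_density_gt0.
have cA0 : (0 < \int[L n]_(x in A) (stereo_density x)%:E)%E.
  by apply: integral_pos_gt0 => // x; exact: stereo_density_gt0.
apply: (@lt_le_trans _ _ (\int[L n]_(x in A) (cB * (stereo_density x)%:E))%E).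
  rewrite ge0_integralZl//; last 3 first.
  - exact/measurable_EFinP/measurable_funTS.
  - by move=> x _; rewrite lee_fin ltW// stereo_density_gt0.
  - exact: ltW.
  exact: mule_gt0.
rewrite integral_mkcond; apply: ge0_le_integral => //.
- move=> x _; rewrite patchE; case: ifPn => // _; apply: mule_ge0; first exact: ltW.
  by rewrite lee_fin ltW// stereo_density_gt0.
- apply/(measurable_restrictT _ mA); apply: measurable_funTS.
  by apply: measurable_funeM; exact/measurable_EFinP.
- apply: emeasurable_funM; last exact/measurable_EFinP.
  exact: (measurableT_comp (measurable_fun_xsection _ mN) ms).
move=> x _; rewrite patchE; case: ifPn => [/set_mem Ax|_]; last first.
  by rewrite mule_ge0// lee_fin ltW// stereo_density_gt0.
apply: lee_pmul => //; first exact: ltW.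
  by rewrite lee_fin ltW// stereo_density_gt0.
rewrite /= surface_measure_stereo//; last exact: measurable_xsection.
apply: ge0_subset_integral => //.
- have mNx := measurable_xsection (stereo x) mN.
  by have := ms measurableT _ mNx; rewrite setTI.
- by apply/measurable_EFinP/measurable_funTS.
- by move=> y _; rewrite lee_fin ltW// stereo_density_gt0.
move=> y By /=; rewrite /xsection /= inE; apply: sub => /= Pxy; apply: nex.
by exists x, y.
Qed.

(** The constant of the Euclidean inequality in terms of the area of the sphere,
since the density of stereographic projection is 2^n times the bubble. *)
Lemma surface_measure_setT n : (0 < n)%N ->
  (0 < fine (surface_measure [set: sphere R n])) /\
  (\int[L n]_x (bubble x)%:E = (2 ^- n * fine (surface_measure [set: sphere R n]))%:E)%E.
Proof.
move=> n0.
have S0 : (0 < surface_measure [set: sphere R n])%E.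
  rewrite surface_measure_stereo// preimage_setT.
  apply: integral_pos_gt0 => //.
  - exact: measurable_stereo_density.
  - by move=> x; exact: stereo_density_gt0.
  - exact: lebesgue_tuple_setT_gt0.
have Sfin : surface_measure [set: sphere R n] \is a fin_num by exact: fin_num_measure.
split; first by rewrite fine_gt0// S0 ltey_eq Sfin.
rewrite EFinM fineK// surface_measure_stereo// preimage_setT.
have mw : measurable_fun setT (fun x : n.-tuple R => (stereo_density x)%:E).
  by apply/measurable_EFinP; exact: measurable_stereo_density.
have w0 (x : n.-tuple R) : [set: n.-tuple R] x -> (0 <= (stereo_density x)%:E)%E.
  by move=> _; rewrite lee_fin ltW// stereo_density_gt0.
have c0 : (0 <= (2 ^- n : R)%:E)%E by rewrite lee_fin invr_ge0 exprn_ge0.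
rewrite -(@ge0_integralZl _ _ _ (L n) _ measurableT _ mw _ w0 c0).
apply: eq_integral => x _; rewrite -EFinM; congr EFin.
rewrite /stereo_density /bubble expr_div_n mulrA mulVf ?mul1r// expf_neq0//.
Qed.

(** The Euclidean inequality for (f o stereo) and (g o stereo) times the density:
the conformal factors of the distance are exactly these densities. That
inequality concerns numbers strictly below the integrals, hence the factor t < 1
at the end. *)
Lemma sphere_inequality1 n (f g : sphere R n -> R) (I J : R) : (0 < n)%N ->
  measurable_fun setT f -> measurable_fun setT g ->
  (forall s, 0 <= f s) -> (forall s, 0 <= g s) ->
  {ae (surface_measure \x surface_measure)%E, forall z : sphere R n * sphere R n,
     f z.1 * g z.2 * Defs.edist z.1 z.2 ^+ (2 * n) <= 1} ->
  (\int[surface_measure]_s (f s)%:E = I%:E)%E ->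
  (\int[surface_measure]_s (g s)%:E = J%:E)%E ->
  I * J <= (2 ^- n * fine (surface_measure [set: sphere R n])) ^+ 2.
Proof.
move=> n0 mf mg f0 g0 fg fI gJ.
set c := 2 ^- n * _.
have [S0 bubbleE] := surface_measure_setT n0.
have c0 : 0 < c by rewrite mulr_gt0.
have int0 (k : sphere R n -> R) (K : R) : (forall s, 0 <= k s) ->
    (\int[surface_measure]_s (k s)%:E = K%:E)%E -> 0 <= K.
  by move=> k0 kK; rewrite -lee_fin -kK integral_ge0// => s _; rewrite lee_fin.
have [->|In0] := eqVneq I 0; first by rewrite mul0r sqr_ge0.
have [->|Jn0] := eqVneq J 0; first by rewrite mulr0 sqr_ge0.
have {In0}I0 : 0 < I by rewrite lt_neqAle eq_sym In0 (int0 f).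
have {Jn0}J0 : 0 < J by rewrite lt_neqAle eq_sym Jn0 (int0 g).
pose f' x := f (stereo x) * stereo_density x.
pose g' x := g (stereo x) * stereo_density x.
have mcomp (k : sphere R n -> R) : measurable_fun setT k ->
    measurable_fun setT (fun x : n.-tuple R => k (stereo x) * stereo_density x).
  move=> mk; apply: measurable_funM; last exact: measurable_stereo_density.
  exact: (measurableT_comp mk (@measurable_stereo R n)).
have ge0 (k : sphere R n -> R) : (forall s, 0 <= k s) ->
    forall x : n.-tuple R, 0 <= k (stereo x) * stereo_density x.
  by move=> k0 x; rewrite mulr_ge0// ltW// stereo_density_gt0.
have intE (k : sphere R n -> R) (K : R) : measurable_fun setT k -> (forall s, 0 <= k s) ->
    (\int[surface_measure]_s (k s)%:E = K%:E)%E ->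
    (\int[L n]_x (k (stereo x) * stereo_density x)%:E = K%:E)%E.
  by move=> mk k0 <-; rewrite integral_sphere//; exact/measurable_EFinP.
have H A B : measurable A -> measurable B -> (0 < L n A)%E -> (0 < L n B)%E ->
    exists x y, [/\ A x, B y & f' x * g' y * Defs.edist x y ^+ (2 * n) <= 1].
  move=> mA mB A0 B0.
  have [x [y [Ax By]]] := rectangle_ae n0 mA mB A0 B0 fg.
  move=> /= xy; exists x, y; split=> //; apply: le_trans xy.
  rewrite le_eqVlt; apply/orP; left; apply/eqP.
  rewrite !exprM edist_stereo /f' /g' /stereo_density.
  move: (2 / _) (2 / _) (Defs.edist x y ^+ 2) => a b D.
  by rewrite !exprMn; ring.
have key t : 0 < t -> t < 1 -> t ^+ 2 * (I * J) <= c ^+ 2.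
  move=> t0 t1.
  have lt (K : R) : 0 < K -> ((t * K)%:E < K%:E)%E.
    by move=> K0; rewrite lte_fin gtr_pMl.
  have tK (K : R) : 0 < K -> 0 <= t * K by move=> K0; rewrite mulr_ge0 ?(ltW t0) ?(ltW K0).
  have := @euclidean_inequality R n f' g' (t * I) (t * J) n0 (mcomp f mf) (mcomp g mg)
    (ge0 f f0) (ge0 g g0) H (tK _ I0) (tK _ J0).
  rewrite (intE f I mf f0 fI) (intE g J mg g0 gJ) bubbleE lee_fin => /(_ (lt _ I0) (lt _ J0)).
  have P0 := mulr_ge0 (tK _ I0) (tK _ J0).
  rewrite -powRM ?tK// powR12_sqrt// => h.
  rewrite (_ : t ^+ 2 * _ = Num.sqrt (t * I * (t * J)) ^+ 2).
    by rewrite ler_pXn2r// nnegrE ?sqrtr_ge0// ltW.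
  by rewrite sqr_sqrtr//; ring.
rewrite leNgt; apply/negP => cIJ.
have IJ0 : 0 < I * J by rewrite mulr_gt0.
(* for q < 1 the square of the mean of 1 and q exceeds q *)
pose q := c ^+ 2 / (I * J).
have q0 : 0 < q by rewrite divr_gt0// exprn_gt0.
have q1 : q < 1 by rewrite ltr_pdivrMr// mul1r.
have qE : q * (I * J) = c ^+ 2 by rewrite divfK// lt0r_neq0.
have := key ((1 + q) / 2); rewrite -qE ler_pM2r//.
have -> : 0 < (1 + q) / 2 by lra.
have -> : (1 + q) / 2 < 1 by lra.
move=> /(_ isT isT); nra.
Qed.

End sphere_inequality.

(** * The sharp constant *)

Section best_constant.
Context {R : realType} {n : nat}.
Local Notation sigma := (@surface_measure R n).
Local Notation S := (fine (sigma [set: sphere R n])).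

Definition sharp_constant (p : R) : R :=
  2 `^ (- (2 * n%:R / p)) * S `^ (2 / p).

Hypothesis n0 : (0 < n)%N.

Let S0 : 0 < S. Proof. by have [] := @surface_measure_setT R n n0. Qed.

Let sharp_constant_gt0 p : 0 < sharp_constant p.
Proof. by rewrite mulr_gt0// powR_gt0. Qed.

Let Lp_norm p (F : sphere R n -> R) : 0 < p -> nonneg_Lp p F ->
  exists N, [/\ 0 <= N, ('N[sigma]_p%:E[EFin \o F] = N%:E)%E &
    (\int[sigma]_s (F s `^ p)%:E = (N `^ p)%:E)%E].
Proof.
move=> p0 [mF F0 Ffin].
have Nfin : ('N[sigma]_p%:E[EFin \o F])%E \is a fin_num by rewrite ge0_fin_numE// Lnorm_ge0.
exists (fine ('N[sigma]_p%:E[EFin \o F])%E); split.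
- by rewrite fine_ge0// Lnorm_ge0.
- by rewrite fineK.
rewrite -poweR_EFin (fineK Nfin) poweR_Lnorm ?lt0r_neq0//.
by apply: eq_integral => s _; rewrite /= ger0_norm.
Qed.

(** The case p = 1 for the functions F^p / M^p and G^p. *)
Lemma Lp_product_bound p (F G : sphere R n -> R) (M : R) : 0 < p -> 0 < M ->
  nonneg_Lp p F -> nonneg_Lp p G -> (ess_sup_kernel p F G <= M%:E)%E ->
  ('N[sigma]_p%:E[EFin \o F] * 'N[sigma]_p%:E[EFin \o G]
    <= (sharp_constant p * M)%:E)%E.
Proof.
move=> p0 M0 LF LG FGM.
have [NF [NF0 -> FE]] := Lp_norm p0 LF; have [NG [NG0 -> GE]] := Lp_norm p0 LG.
have [mF F0 _] := LF; have [mG G0 _] := LG.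
have pn0 := lt0r_neq0 p0.
have Mp0 : 0 < M `^ p by exact: powR_gt0.
rewrite -EFinM lee_fin leNgt; apply/negP => lt.
have BM0 : 0 <= sharp_constant p * M by rewrite mulr_ge0 ?ltW.
have : (sharp_constant p * M) `^ p < (NF * NG) `^ p.
  by apply: gt0_ltr_powR; rewrite ?nnegrE// mulr_ge0.
apply/negP; rewrite -leNgt.
have -> : (sharp_constant p * M) `^ p = (2 ^- n * S) ^+ 2 * M `^ p.
  rewrite powRM ?ltW// powRM ?powR_ge0// -!powRrM mulNr !divfK//.
  rewrite exprMn exprVn -exprM powRN -[2 * n%:R]natrM powR_mulrn//.
  by rewrite powR_mulrn ?ltW// [(n * 2)%N]mulnC.
rewrite powRM// -ler_pdivrMr// mulrAC [_ / _]mulrC.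
have mpow (K : sphere R n -> R) : measurable_fun setT K ->
    measurable_fun setT (fun s => K s `^ p).
  by move=> mK; apply: (measurableT_comp (f := @powR R ^~ p)) => //; exact: measurable_powR.
apply: (@sphere_inequality1 R n (fun s => (M `^ p)^-1 * F s `^ p) (fun s => G s `^ p)) => //.
- by apply: measurable_funM => //; exact: mpow.
- exact: mpow.
- by move=> s; rewrite mulr_ge0 ?powR_ge0// invr_ge0 ltW.
- by move=> s; exact: powR_ge0.
- move/ess_supP : FGM; apply: filterS => -[s t] /=; rewrite lee_fin => FGM.
  have d0 : 0 <= Defs.edist s t by exact: sqrtr_ge0.
  rewrite -!mulrA mulrC ler_pdivrMr// mul1r.
  have /(ge0_ler_powR (ltW p0)) : F s * G t * Defs.edist s t `^ (2 * n%:R / p) <= M by [].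
  rewrite !nnegrE (ltW M0) !mulr_ge0 ?powR_ge0// => /(_ isT isT).
  rewrite powRM ?powR_ge0 ?mulr_ge0// powRM// -powRrM divfK//.
  by rewrite -[2 * n%:R]natrM powR_mulrn// mulrA.
under eq_integral do rewrite EFinM.
rewrite ge0_integralZl//.
- by rewrite FE -EFinM.
- by apply/measurable_EFinP; exact: mpow.
- by move=> s _; rewrite lee_fin powR_ge0.
- by rewrite lee_fin invr_ge0 ltW.
Qed.

Let sigma_setT : sigma [set: sphere R n] = S%:E.
Proof. by rewrite fineK// fin_num_measure. Qed.

Let product_setT_gt0 : (0 < (sigma \x sigma) [set: sphere R n * sphere R n])%E.
Proof.
have sT0 : (0 < sigma [set: sphere R n])%E by rewrite sigma_setT lte_fin.
by rewrite -setXTT product_measure1E//; exact: mule_gt0.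
Qed.

Lemma ess_sup_kernel_ge0 p (F G : sphere R n -> R) :
  (forall s, 0 <= F s) -> (forall s, 0 <= G s) -> (0 <= ess_sup_kernel p F G)%E.
Proof.
move=> F0 G0; apply: ess_sup_gee product_setT_gt0 _.
by apply: nearW => z; rewrite lee_fin !mulr_ge0// powR_ge0.
Qed.

(** The essential supremum may vanish, so it is approached from above by positive
bounds. *)
Lemma sphere_inequality p (F G : sphere R n -> R) : 0 < p ->
  nonneg_Lp p F -> nonneg_Lp p G ->
  ('N[sigma]_p%:E[EFin \o F] * 'N[sigma]_p%:E[EFin \o G]
    <= (sharp_constant p)%:E * ess_sup_kernel p F G)%E.
Proof.
move=> p0 LF LG; have B0 := sharp_constant_gt0 p.
have [_ F0 _] := LF; have [_ G0 _] := LG.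
have := ess_sup_kernel_ge0 p F0 G0; case E : (ess_sup_kernel p F G) => [m| |]// m0.
  apply/lee_addgt0Pr => e e0.
  have [M0 mM] : 0 < m + e / sharp_constant p /\ m <= m + e / sharp_constant p.
    have : 0 < e / sharp_constant p by rewrite divr_gt0.
    by move: m0; rewrite lee_fin; split; lra.
  rewrite -EFinM -EFinD (_ : _ + e = sharp_constant p * (m + e / sharp_constant p)).
    by apply: Lp_product_bound => //; rewrite E lee_fin.
  by field; rewrite lt0r_neq0.
by rewrite gt0_muley ?lte_fin// leey.
Qed.

Lemma Lnorm_cst p (a : R) : 0 < p -> 0 <= a ->
  ('N[sigma]_p%:E[EFin \o (cst a : sphere R n -> R)] = (a * S `^ p^-1)%:E)%E.
Proof.
move=> p0 a0; rewrite unlock /Lnorm.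
rewrite (eq_integral (cst (a `^ p)%:E)); last first.
  by move=> s _; rewrite /= ger0_norm.
rewrite integral_cst// [X in (_ * X)%E]sigma_setT -EFinM poweR_EFin powRM ?powR_ge0 ?(ltW S0)//.
by rewrite -powRrM mulfV ?lt0r_neq0// powRr1.
Qed.

Lemma nonneg_Lp_cst p (a : R) : 0 < p -> 0 <= a ->
  nonneg_Lp p (cst a : sphere R n -> R).
Proof. by move=> p0 a0; split=> //; rewrite /finite_norm Lnorm_cst// ltry. Qed.

Lemma edist_sphere_le2 (s t : sphere R n) : Defs.edist s t <= 2.
Proof.
have sq (u : sphere R n) : \sum_(i < n.+1) tnth u i ^+ 2 = 1.
  have := sphere_enorm u; rewrite /enorm => /(congr1 (fun x => x ^+ 2)).
  by rewrite sqr_sqrtr ?expr1n// sumr_ge0// => i _; exact: sqr_ge0.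
rewrite -(@ler_pXn2r _ 2)// ?nnegrE ?sqrtr_ge0// sqr_sqrtr; last first.
  by rewrite sumr_ge0// => i _; exact: sqr_ge0.
apply: (@le_trans _ _ (\sum_(i < n.+1) (2 * tnth s i ^+ 2 + 2 * tnth t i ^+ 2))).
  apply: ler_sum => i _; rewrite -subr_ge0.
  rewrite (_ : _ - _ = (tnth s i + tnth t i) ^+ 2); [exact: sqr_ge0|by ring].
by rewrite big_split/= -!mulr_sumr !sq; lra.
Qed.

Lemma norm_product_cst p (a b : R) : 0 < p -> 0 < a -> 0 < b ->
  ('N[sigma]_p%:E[EFin \o (cst a : sphere R n -> R)] *
   'N[sigma]_p%:E[EFin \o (cst b : sphere R n -> R)] =
   (sharp_constant p * (a * b * 2 `^ (2 * n%:R / p)))%:E)%E.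
Proof.
move=> p0 a0 b0; rewrite !Lnorm_cst ?ltW// -EFinM; congr EFin.
rewrite /sharp_constant powRN (_ : 2 / p = p^-1 + p^-1); last by ring.
rewrite powRD; last by rewrite (lt0r_neq0 S0) implybT.
have : (2 : R) `^ (2 * n%:R / p) != 0 by rewrite lt0r_neq0// powR_gt0.
by move: (2 `^ _) => c c0; field.
Qed.

(** That |s - t| is essentially as large as 2 follows from the inequality itself,
applied to the constants. *)
Lemma ess_sup_kernel_cst p (a b : R) : 0 < p -> 0 < a -> 0 < b ->
  (ess_sup_kernel p (cst a : sphere R n -> R) (cst b) =
   (a * b * 2 `^ (2 * n%:R / p))%:E)%E.
Proof.
move=> p0 a0 b0; have B0 := sharp_constant_gt0 p; apply/le_anti/andP; split.
  apply/ess_supP; apply: nearW => -[s t] /=; rewrite lee_fin ler_pM2l ?mulr_gt0//.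
  apply: ge0_ler_powR; rewrite ?nnegrE ?sqrtr_ge0//; last exact: edist_sphere_le2.
  by rewrite divr_ge0 ?mulr_ge0// ltW.
have := sphere_inequality p0 (nonneg_Lp_cst p0 (ltW a0)) (nonneg_Lp_cst p0 (ltW b0)).
by rewrite norm_product_cst// EFinM lee_pmul2l.
Qed.

End best_constant.

Theorem theorem4p4 (R : realType) (n : nat) (p : R) (hn : (1 <= n)%N)
    (hp : 0 < p) :
  exists B : R,
    [/\ forall F G : sphere R n -> R, nonneg_Lp p F -> nonneg_Lp p G ->
          ('N[surface_measure]_p%:E[EFin \o F] *
           'N[surface_measure]_p%:E[EFin \o G]
             <= B%:E * ess_sup_kernel p F G)%E,
        forall C : R,
          (forall F G : sphere R n -> R, nonneg_Lp p F -> nonneg_Lp p G ->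
            ('N[surface_measure]_p%:E[EFin \o F] *
             'N[surface_measure]_p%:E[EFin \o G]
               <= C%:E * ess_sup_kernel p F G)%E) -> B <= C,
        forall a b : R, 0 < a -> 0 < b ->
          ('N[surface_measure]_p%:E[EFin \o (cst a : sphere R n -> R)] *
           'N[surface_measure]_p%:E[EFin \o (cst b : sphere R n -> R)]
             = B%:E * ess_sup_kernel p (cst a : sphere R n -> R) (cst b))%E &
        B = 2 `^ (- (2 * n%:R / p)) *
            fine (surface_measure [set: sphere R n]) `^ (2 / p)].
Proof.
exists (@sharp_constant R n p); split=> //.
- by move=> F G; exact: sphere_inequality.
- move=> C /(_ _ _ (nonneg_Lp_cst hn hp ler01) (nonneg_Lp_cst hn hp ler01)).
  rewrite norm_product_cst// ess_sup_kernel_cst// -EFinM lee_fin.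
  by rewrite ler_pM2r// !mulr_gt0// powR_gt0.
- by move=> a b a0 b0; rewrite norm_product_cst// ess_sup_kernel_cst// EFinM.
Qed.
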